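(* There exists a unique family $\{\mu_y\}_{y\in Y}$ of Borel probability measures on $K$ satisfying $$\mu_y=\sum_{i\in\Sigma_N} G_i(y)\,\mu_{H_i(y)}\circ S_i^{-1}\qquad\text{for all } y\in Y.$$ Furthermore, for every $y\in Y$ the following two statements hold. (i) Assume that there exist a constant $\epsilon_0\in\left(0,(\min_{i\in\Sigma_N} r_i)^s\right)$ and an integer $l\ge 1$ such that for every $i_1,\dots,i_l\in\Sigma_N$, $$Y(y)\cap\bigcap_{i\in\Sigma_N}G_i^{-1}\left([r_i^s-\epsilon_0,r_i^s+\epsilon_0]\right)\cap\bigcap_{j\in\Sigma_N}\left(G_j\circ H_{i_l}\circ\cdots\circ H_{i_1}\right)^{-1}\left([r_j^s-\epsilon_0,r_j^s+\epsilon_0]\right)=\emptyset .$$ Then $\dim_H\mu_y<s$. (ii) Assume that there exist constants $r\in(0,1)$, $c>0$ and $D>0$ such that for every $x\in K$ and every $m\ge1$, $$\left|\left\{(i_1,\dots,i_m)\in(\Sigma_N)^m \;:\; B(x,cr^m)\cap K_{i_1\cdots i_m}\neq\emptyset\right\}\right|\le D,$$ and furthermore that for some $i\in\Sigma_N$ and some $c'>0$, $$c'\le\inf_{w\in Y(y)}G_i(w)\le\sup_{w\in Y(y)}G_i(w)\le 1-c'.$$ Then $\dim_H\mu_y>0$.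
   Context: Let $N\ge2$ and $\Sigma_N=\{0,1,\dots,N-1\}$. Let $S_i$, $i\in\Sigma_N$, be contractive maps on a complete metric space $(M,d)$, and let $K$ be the attractor of the iterated function system $\{S_i\}_{i\in\Sigma_N}$ (the unique nonempty compact set with $K=\bigcup_i S_i(K)$), equipped with its Borel $\sigma$-algebra. Let $r_i=\sup_{x\ne y} d(S_i(x),S_i(y))/d(x,y)$ be the Lipschitz constant of $S_i$, and assume $0<r_i<1$ for each $i$. Let $s>0$ be the number with $\sum_{i\in\Sigma_N}r_i^s=1$. For $x\in K$, $\rho>0$, $B(x,\rho)=\{y\in K: d(x,y)\le\rho\}$. Write $S_{i_1\cdots i_m}=S_{i_1}\circ\cdots\circ S_{i_m}$ and $K_{i_1\cdots i_m}=S_{i_1\cdots i_m}(K)$. Let $Y$ be a set, $H_i:Y\to Y$ and $G_i:Y\to[0,1]$, $i\in\Sigma_N$, be maps with $\sum_{i\in\Sigma_N}G_i(y)=1$ for every $y\in Y$. For $y\in Y$ let $Y(y)=\{H_{i_l}\circ\cdots\circ H_{i_1}(y): i_1,\dots,i_l\in\Sigma_N,\ l\ge1\}$. $\dim_H A$ denotes the Hausdorff dimension of $A\subset K$, and for a Borel probability measure $\mu$ on $K$, $\dim_H\mu=\inf\{\dim_H B: B \text{ Borel},\ \mu(B)=1\}$. *)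

(* Defs.v *)
From HB Require Import structures.
From mathcomp Require Import all_boot all_order all_algebra.
From mathcomp Require Import all_classical all_reals all_analysis.

Set Implicit Arguments.
Unset Strict Implicit.
Unset Printing Implicit Defensive.

Import Order.TTheory GRing.Theory Num.Theory.

Local Open Scope classical_set_scope.
Local Open Scope ring_scope.

(* The base point that Complete carries costs no generality for a space that
   contains a nonempty attractor. *)
#[short(type="completeMetricType")]
HB.structure Definition CompleteMetric (R : numDomainType) :=
  {M of Metric R M & Complete M}.

Section metric.
Context {R : realType} {M : metricType R}.
Implicit Types (A : set M) (f : M -> M) (t delta : R).

Definition contractive f : Prop :=
  exists2 q : R, 0 <= q < 1 & forall x y, mdist (f x) (f y) <= q * mdist x y.

(* The real-valued sup is the true supremum for contractive f and M with at
   least two points; otherwise its value may be the default 0. *)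
Definition lipschitz_const f : R :=
  sup [set q | exists x y, x != y /\ q = mdist (f x) (f y) / mdist x y].

Definition diameter A : \bar R :=
  ereal_sup [set (mdist x y)%:E | x in A & y in A].

(* |A|^t, with |set0|^t = 0 for every t, and |A|^0 = 1 for nonempty A. *)
Definition diam_pow t A : \bar R :=
  if A == set0 then 0%E else (diameter A `^ t)%E.

Definition hausdorff_premeasure t delta A : \bar R :=
  ereal_inf [set (\sum_(0 <= n <oo) diam_pow t (U n))%E | U in
    [set U : (set M)^nat |
      A `<=` \bigcup_n U n /\ forall n, (diameter (U n) <= delta%:E)%E]].

Definition hausdorff_measure t A : \bar R :=
  ereal_sup [set hausdorff_premeasure t delta A | delta in [set e | 0 < e]].

Definition hausdorff_dim A : \bar R :=
  ereal_inf [set t%:E | t in [set t | 0 <= t /\ hausdorff_measure t A = 0%E]].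

End metric.

(* K as a topological space of its own. The nonemptiness proof is an argument
   because measurable types are required to be pointed. *)
Definition nonempty_set_type (T : Type) (K : set T) (K0 : K !=set0) : Type :=
  set_type K.

Section nonempty_set_type.
Context {T : topologicalType} {K : set T} (K0 : K !=set0).

HB.instance Definition _ :=
  Topological.copy (nonempty_set_type K0) (set_type K).

HB.instance Definition _ := isPointed.Build (nonempty_set_type K0)
  (exist _ (projT1 (cid K0)) (mem_set (projT2 (cid K0)))).

End nonempty_set_type.

Notation borel_type K0 :=
  (g_sigma_algebraType (@open (nonempty_set_type K0))).

Section measure_on_subset.
Context {R : realType} {M : metricType R} {K : set M} {K0 : K !=set0}.

Definition set_val_of (x : borel_type K0) : M := set_val (x : set_type K).

(* S^-1(A), as a subset of K, for S : M -> M and A a subset of K. *)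
Definition preimage_in (S : M -> M) (A : set (borel_type K0)) :
  set (borel_type K0) := set_val_of @^-1` (S @^-1` (set_val_of @` A)).

Definition measure_dim (mu : probability (borel_type K0) R) : \bar R :=
  ereal_inf [set hausdorff_dim (set_val_of @` B) | B in
    [set B : set (borel_type K0) | measurable B /\ mu B = 1%E]].

Definition invariant_family (N : nat) (S : 'I_N -> M -> M) (Y : Type)
    (H : 'I_N -> Y -> Y) (G : 'I_N -> Y -> R)
    (mu : Y -> probability (borel_type K0) R) : Prop :=
  forall y (A : set (borel_type K0)), measurable A ->
    mu y A = (\sum_(i < N) (G i y)%:E * mu (H i y) (preimage_in (S i) A))%E.

End measure_on_subset.

Section words.
Context {N : nat}.

(* S_{i_1} \o ... \o S_{i_m} : the last letter acts first. *)
Definition compose_word (T : Type) (S : 'I_N -> T -> T) (w : seq 'I_N) (x : T) :=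
  foldr S x w.

(* H_{i_l} \o ... \o H_{i_1} : the first letter acts first. *)
Definition follow_word (Y : Type) (H : 'I_N -> Y -> Y) (w : seq 'I_N) (y : Y) :=
  foldl (fun z i => H i z) y w.

Definition orbit_set (Y : Type) (H : 'I_N -> Y -> Y) (y : Y) : set Y :=
  [set follow_word H w y | w in [set w : seq 'I_N | (1 <= size w)%N]].

End words.

Section cylinders.
Context {R : realType} {M : metricType R}.

Definition cylinder (N : nat) (S : 'I_N -> M -> M) (K : set M)
    (w : seq 'I_N) : set M := compose_word S w @` K.

Definition closed_ball_in (K : set M) (x : M) (rho : R) : set M :=
  [set y | K y /\ mdist x y <= rho].

End cylinders.

(* Main.v *)
(* Iterating the equation expresses mu_y through cylinders: mu_y(A) is the sum,
   over the words w of length n, of P_y(w) times the mass that another measure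
   of the family gives to the preimage of A under S_w, where P_y(w) is the
   product of the G_i met while reading w. Hence mu_y(A) lies between the
   P_y-weight of the cylinders inside A and that of the cylinders meeting A,
   which determines mu_y on open sets. For existence, read a number of ]0, 1]
   as an infinite word whose digit i is chosen with probability G_i of the
   current state, and push Lebesgue measure forward to the coded point of K.

   (i) The Hellinger affinity sum_w sqrt(P_y(w) r_w^s) of the two laws on words
   of length n loses a constant factor at least every l + 1 letters, so it is at
   most C gam^n. Hence, up to P_y-weight C gam^(n/2), words satisfy
   r_w^s <= gam^n P_y(w); the limsup of their cylinders has full measure, and
   for t < s close to s the sum of r_w^t over them is still geometrically small.

   (ii) P_y(w) is at most (1 - c')^(|w| - 1), and a ball of radius c rho^m meets
   at most D cylinders of level m, so the mass of a ball is at most a constant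
   times a positive power of its radius: mass distribution principle. *)
From HB Require Import structures.
Require Import Defs.
From mathcomp Require Import all_boot all_order all_algebra.
From mathcomp Require Import all_classical all_reals all_analysis.
From mathcomp Require Import measurable_realfun lra ring zify.

Set Implicit Arguments.
Unset Strict Implicit.
Unset Printing Implicit Defensive.

Import Order.TTheory GRing.Theory Num.Theory.
Import numFieldNormedType.Exports.

Local Open Scope classical_set_scope.
Local Open Scope ring_scope.

(** * Sums over words of fixed length *)

Section word_sums.
Context {N : nat}.

Lemma big_tuple_cons (T : nmodType) n (F : seq 'I_N -> T) :
  \sum_(w : n.+1.-tuple 'I_N) F w =
  \sum_(i < N) \sum_(w : n.-tuple 'I_N) F (i :: w).
Proof.
rewrite pair_big /=.
rewrite (reindex (fun u : 'I_N * n.-tuple 'I_N => [tuple of u.1 :: u.2])) //=.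
exists (fun w : n.+1.-tuple 'I_N => (thead w, [tuple of behead w])).
  by move=> [i w] _ /=; rewrite theadE; congr pair; apply: val_inj.
by move=> w _; rewrite /= -tuple_eta.
Qed.

Lemma big_tuple_nil (T : nmodType) (F : seq 'I_N -> T) :
  \sum_(w : 0.-tuple 'I_N) F w = F [::].
Proof.
rewrite (eq_bigr (fun=> F [::])) ?sumr_const ?card_tuple ?expn0//.
by move=> w _; rewrite tuple0.
Qed.

(** Grouped by length, distinct words are some of the tuples of that length, and the missing terms
    are nonnegative. This turns an enumeration of words into sums level by level. *)
Lemma big_tuple_seq (R : realDomainType) (F : seq 'I_N -> R) (L : nat)
    (u : seq (seq 'I_N)) : (forall w, 0 <= F w) -> uniq u ->
  (forall w, w \in u -> size w < L)%N ->
  \sum_(w <- u) F w <= \sum_(k < L) \sum_(w : k.-tuple 'I_N) F w.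
Proof.
move=> F0 uu uL.
have -> : \sum_(w <- u) F w =
    \sum_(k < L) \sum_(w <- u | size w == k) F w.
  rewrite (exchange_big_dep xpredT)//= big_seq [RHS]big_seq.
  apply: eq_bigr => w /uL wL.
  by apply/esym/(big_pred1 (Ordinal wL)) => k.
apply: ler_sum => k _.
rewrite -big_filter.
have -> : \sum_(i <- [seq i <- u | size i == k]) F i =
    \sum_(w : k.-tuple 'I_N | val w \in u) F w.
  rewrite [RHS](_ : _ = \sum_(w <-
      [seq val w | w <- enum [pred w : k.-tuple 'I_N | val w \in u]]) F w).
    apply: perm_big; apply: uniq_perm.
    - exact: filter_uniq.
    - by rewrite map_inj_uniq ?enum_uniq//; exact: val_inj.
    move=> w; rewrite mem_filter; apply/andP/mapP => [[wk wu]|[t + ->]].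
      by exists (Tuple wk); rewrite ?mem_enum.
    by rewrite mem_enum inE => ->; rewrite size_tuple eqxx.
  by rewrite big_map big_enum.
by rewrite [leRHS](bigID (fun w : k.-tuple 'I_N => val w \in u))/= lerDl sumr_ge0.
Qed.

End word_sums.

(** * Word probabilities and decay of the Hellinger affinity *)

Section word_prob.
Context {R : realType} {N : nat} {Y : Type}.
Variables (H : 'I_N -> Y -> Y) (G : 'I_N -> Y -> R).
Hypothesis G0 : forall i y, 0 <= G i y.
Hypothesis G1 : forall y, \sum_(i < N) G i y = 1.

Fixpoint word_prob (z : Y) (w : seq 'I_N) : R :=
  if w is i :: w' then G i z * word_prob (H i z) w' else 1.

Lemma word_prob_ge0 z w : 0 <= word_prob z w.
Proof. by elim: w z => //= i w IH z; rewrite mulr_ge0. Qed.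

Lemma sum_word_prob n z : \sum_(w : n.-tuple 'I_N) word_prob z w = 1.
Proof.
elim: n z => [|n IH] z; first by rewrite big_tuple_nil.
rewrite big_tuple_cons/= -[RHS](G1 z); apply: eq_bigr => i _.
by rewrite -mulr_sumr IH mulr1.
Qed.

Variable p : 'I_N -> R.
Hypothesis p0 : forall i, 0 <= p i.
Hypothesis p1 : \sum_(i < N) p i = 1.

(** A transfer operator on functions of the state: pointwise bounds on its iterates separate the
    gain made at one letter from the rest of the word. *)
Definition affinity_step (g : Y -> R) (z : Y) : R :=
  \sum_(i < N) Num.sqrt (G i z * p i) * g (H i z).

Definition affinity n : Y -> R := iter n affinity_step (fun=> 1).

(* The Hellinger affinity of the two laws induced on words of length n. *)
Lemma affinityE n z :
  affinity n z =
  \sum_(w : n.-tuple 'I_N) Num.sqrt (word_prob z w * \prod_(i <- w) p i).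
Proof.
elim: n z => [|n IH] z.
  rewrite (big_tuple_nil (fun w => Num.sqrt (word_prob z w * \prod_(i <- w) p i))).
  by rewrite big_nil/= mulr1 sqrtr1.
rewrite (big_tuple_cons _ (fun w => Num.sqrt (word_prob z w * \prod_(i <- w) p i))).
rewrite /affinity iterS /affinity_step; apply: eq_bigr => i _.
rewrite -/(affinity n) IH mulr_sumr; apply: eq_bigr => w _.
rewrite big_cons /= -sqrtrM ?mulr_ge0//; congr Num.sqrt; ring.
Qed.

Lemma affinity_step_le g z c : (forall i, g (H i z) <= c) ->
  affinity_step g z <= affinity 1 z * c.
Proof.
move=> gc; rewrite /affinity/= /affinity_step mulr_suml ler_sum// => i _.
by rewrite mulr1 ler_wpM2l// sqrtr_ge0.
Qed.

(** Expand the squares and use that [G ^~ z] and [p] both sum to 1. The affinity of one letter is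
    thus at most 1, with an explicit loss. *)
Lemma affinity1_defect z :
  1 - affinity 1 z =
  2^-1 * \sum_(i < N) (Num.sqrt (G i z) - Num.sqrt (p i)) ^+ 2.
Proof.
have -> : \sum_(i < N) (Num.sqrt (G i z) - Num.sqrt (p i)) ^+ 2 =
    \sum_(i < N) (G i z + p i - (Num.sqrt (G i z * p i) * 1) *+ 2).
  apply: eq_bigr => i _; rewrite sqrrB !sqr_sqrtr// mulr1 sqrtrM//.
  by ring.
rewrite sumrB big_split/= G1 p1 sumrMnl /affinity/= /affinity_step.
by field.
Qed.

Lemma affinity1_le1 z : affinity 1 z <= 1.
Proof.
by rewrite -subr_ge0 affinity1_defect mulr_ge0// sumr_ge0// => i _; rewrite sqr_ge0.
Qed.

(** Square roots of probabilities are at most 1, so [e] is at most twice the difference of the two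
    roots at [i]. One square of the defect is then at least [e ^+ 2 / 4], and the factor [2^-1]
    yields the 8. *)
Lemma affinity1_gap z i e : 0 <= e -> e < `|G i z - p i| ->
  affinity 1 z <= 1 - e ^+ 2 / 8.
Proof.
move=> e0 ei; rewrite -lerBlDr opprK -lerBrDl affinity1_defect.
have le1 (q : 'I_N -> R) : (forall j, 0 <= q j) -> \sum_(j < N) q j = 1 ->
    Num.sqrt (q i) <= 1.
  move=> q0 q1; rewrite -[leRHS]sqrtr1 ler_sqrt// -q1 (bigD1 i)//= lerDl.
  by rewrite sumr_ge0.
have ai : (Num.sqrt (G i z) - Num.sqrt (p i)) ^+ 2 <=
    \sum_(j < N) (Num.sqrt (G j z) - Num.sqrt (p j)) ^+ 2.
  by rewrite [leRHS](bigD1 i)//= lerDl sumr_ge0// => j _; rewrite sqr_ge0.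
have aG := le1 _ (G0 ^~ z) (G1 z); have ap := le1 _ p0 p1.
have := sqr_sqrtr (G0 i z); have := sqr_sqrtr (p0 i).
have := sqrtr_ge0 (G i z); have := sqrtr_ge0 (p i).
move: aG ap ai ei.
set a := Num.sqrt (G i z); set b := Num.sqrt (p i).
move=> aG ap ai ei b0 a0 bE aE; rewrite -aE -bE in ei.
rewrite subr_sqr normrM (ger0_norm (addr_ge0 a0 b0)) in ei.
have nn := normr_ge0 (a - b).
have e2 : e <= `|a - b| * 2.
  by apply: (le_trans (ltW ei)); rewrite ler_wpM2l//; lra.
have : e ^+ 2 <= (`|a - b| * 2) ^+ 2 by rewrite lerXn2r ?nnegrE ?mulr_ge0.
by rewrite exprMn real_normK ?num_real//; move: ai; lra.
Qed.

Variable O : set Y.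
Hypothesis OH : forall i z, O z -> O (H i z).

Lemma affinity_step_orbit_le g c z : 0 <= c -> (forall y, O y -> g y <= c) ->
  O z -> affinity_step g z <= c.
Proof.
move=> c0 gc Oz; apply: (@le_trans _ _ (affinity 1 z * c)).
  by apply: affinity_step_le => i; apply/gc/OH.
by rewrite -[leRHS]mul1r ler_wpM2r ?affinity1_le1.
Qed.

Lemma iter_affinity_step_orbit_le k g c z : 0 <= c ->
  (forall y, O y -> g y <= c) -> O z -> iter k affinity_step g z <= c.
Proof.
move=> c0 gc; elim: k z => [|k IH] z Oz; first exact: gc.
by rewrite iterS; apply: affinity_step_orbit_le.
Qed.

(** Here the bound on [g] is needed only at states reached after exactly [k] letters, which suits a
    gain made at a known position. *)
Lemma iter_affinity_step_word_le k g c z : 0 <= c ->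
  (forall w : k.-tuple 'I_N, g (follow_word H w z) <= c) ->
  iter k affinity_step g z <= c.
Proof.
move=> c0; elim: k z => [|k IH] z gc; first exact: (gc [tuple]).
rewrite iterS; apply: (@le_trans _ _ (affinity 1 z * c)).
  apply: affinity_step_le => i.
  by apply: IH => w; exact: (gc [tuple of i :: w]).
by rewrite -[leRHS]mul1r ler_wpM2r ?affinity1_le1.
Qed.

(* Along l + 1 consecutive letters each path meets a state at which the step
   affinity is at most 1 - e ^+ 2 / 8. *)
Lemma affinity_decay e l : 0 < e < 1 ->
  (forall z (w : l.-tuple 'I_N), O z ->
    (exists i, e < `|G i z - p i|) \/
    (exists i, e < `|G i (follow_word H w z) - p i|)) ->
  exists gam C : R, [/\ 0 < gam < 1, 0 < C &
    forall n z, O z -> affinity n z <= C * gam ^+ n].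
Proof.
move=> /andP[e0 e1] bad.
pose beta := 1 - e ^+ 2 / 8.
have e21 : e ^+ 2 < 1 by rewrite expr_lt1// ltW.
have e20 : 0 < e ^+ 2 by rewrite exprn_gt0.
have beta0 : 0 < beta by rewrite /beta; lra.
have beta1 : beta < 1 by rewrite /beta; lra.
(* Chosen so that a loss of [beta] per [l + 1] letters is a loss of [gam] per letter. The constant
   [beta^-1] absorbs words of at most [l] letters. *)
pose gam := beta `^ (l.+1%:R^-1).
have gamE : gam ^+ l.+1 = beta.
  by rewrite -powR_mulrn ?powR_ge0// -powRrM mulVf// powRr1// ltW.
have gam0 : 0 < gam by rewrite powR_gt0.
have gam1 : gam < 1.
  rewrite ltNge; apply/negP => g1.
  by have := exprn_ege1 l.+1 g1; rewrite gamE leNgt beta1.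
exists gam, beta^-1; split; rewrite ?gam0 ?gam1 ?invr_gt0//.
elim/ltn_ind => n IH z Oz.
have [nl|ln] := leqP n l.
  apply: (@le_trans _ _ 1).
    by apply: iter_affinity_step_orbit_le.
  rewrite ler_pdivlMl// mulr1 -gamE; apply: ler_wiXn2l => //.
  - exact: ltW.
  - exact: ltW.
  - exact: leqW.
have -> : (n = (n - l.+1) + l.+1)%N by rewrite subnK.
set m := (n - l.+1)%N; have mn : (m < n)%N by rewrite /m; lia.
have am y : O y -> affinity m y <= beta^-1 * gam ^+ m by exact: IH.
have c0 : 0 <= beta^-1 * gam ^+ m by rewrite mulr_ge0 ?invr_ge0 ?exprn_ge0 ?ltW.
rewrite exprD gamE mulrA [leRHS]mulrC.
have badstep g y : (exists i, e < `|G i y - p i|) ->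
    (forall i, g (H i y) <= beta^-1 * gam ^+ m) ->
    affinity_step g y <= beta * (beta^-1 * gam ^+ m).
  move=> [i ei] gy; apply: (le_trans (affinity_step_le gy)).
  by rewrite ler_wpM2r// (affinity1_gap (ltW e0) ei).
have aE k : affinity (m + k) = iter k affinity_step (affinity m).
  by rewrite /affinity addnC iterD.
(* If the starting state is bad, the gain comes at the first of the [l + 1] letters; otherwise every
   state reached after [l] letters is bad and the gain comes at the last one. *)
have [bz|gz] := pselect (exists i, e < `|G i z - p i|).
  rewrite addnS /affinity iterS -/(affinity _) aE; apply: badstep => // i.
  by apply: iter_affinity_step_orbit_le => //; exact: OH.
rewrite -addSnnS addnC {1}/affinity iterD -/(affinity _).
apply: iter_affinity_step_word_le; first by rewrite mulr_ge0// ltW.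
have Of (w : seq 'I_N) : O (follow_word H w z).
  by elim: w z Oz {gz} => //= i w IHw z Oz; apply: IHw; exact: OH.
move=> w; apply: badstep => [|i]; last by apply: am; exact: OH.
by have [/gz|] := bad z w Oz.
Qed.

End word_prob.

(** * Partition of the unit interval according to a probability vector *)

Section unit_interval_partition.
Context {R : realType}.

(** The rescaled pushforward gives half-open intervals their length, which characterizes Lebesgue
    measure. *)
Lemma lebesgue_affine_preimage (a g : R) (A : set R) : 0 < g -> measurable A ->
  lebesgue_measure ((fun u => (u - a) / g) @^-1` A) =
  (g%:E * lebesgue_measure A)%E.
Proof.
move=> g0 mA.
pose f (u : measurableTypeR R) : measurableTypeR R := (u - a) / g.
have mf : measurable_fun setT f.
  by apply: measurable_funM => //; apply: measurable_funB.
pose V : R := g^-1.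
have V0 : 0 <= V by rewrite invr_ge0 ltW.
pose nu := mscale (NngNum V0) (pushforward (@lebesgue_measure R) f).
suff -> : lebesgue_measure A = nu mf A.
  by rewrite /nu /mscale/= muleA -EFinM divff ?mul1e// gt_eqF.
apply: (@lebesgue_measure_unique _ (nu mf)) => // _ [[x y] _ <-]/=.
rewrite /nu /mscale/= /pushforward.
have -> : f @^-1` `]x, y]%classic = `]g * x + a, g * y + a]%classic.
  apply/seteqP; split => u /=; rewrite !in_itv/= /f;
    by rewrite ltr_pdivlMr// ler_pdivrMr// ltrBrDr lerBlDr ![_ * g]mulrC.
rewrite !lebesgue_measure_itv/= !lte_fin ltrD2r ltr_pM2l//.
case: ifPn => xy; last by rewrite mule0.
rewrite -!EFinB -EFinM; congr EFin; rewrite /V; field; rewrite gt_eqF//.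
Qed.

Context {N : nat}.
Variable g : 'I_N -> R.
Hypothesis g0 : forall i, 0 <= g i.
Hypothesis g1 : \sum_(i < N) g i = 1.

Definition cumul (k : nat) : R := \sum_(i < N | (i < k)%N) g i.

(** Open on the left, so that a letter of weight 0 gets the empty interval. *)
Definition digit_itv (i : 'I_N) : set R := `]cumul i, cumul i + g i]%classic.

Lemma cumul0 : cumul 0 = 0.
Proof. by rewrite /cumul big1. Qed.

Lemma cumulS (i : 'I_N) : cumul i.+1 = cumul i + g i.
Proof.
rewrite /cumul (bigD1 i)//= addrC; congr (_ + _).
by apply: eq_bigl => j; rewrite ltnS ltn_neqAle andbC.
Qed.

Lemma cumulN : cumul N = 1.
Proof. by rewrite -g1 /cumul; apply: eq_bigl => i; rewrite ltn_ord. Qed.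

Lemma le_cumul (k l : nat) : (k <= l)%N -> cumul k <= cumul l.
Proof.
move=> kl; rewrite /cumul [leRHS](bigID (fun i : 'I_N => (i < k)%N))/=.
rewrite [X in _ <= X + _](eq_bigl (fun i : 'I_N => (i < k)%N)); last first.
  by move=> i; rewrite andb_idl// => /leq_trans; apply.
by rewrite lerDl sumr_ge0.
Qed.

Lemma digit_itv_disjoint i j u : digit_itv i u -> digit_itv j u -> i = j.
Proof.
rewrite /digit_itv /= !in_itv/= -!cumulS => /andP[iu ui] /andP[ju uj].
apply: val_inj; apply/eqP; rewrite eqn_leq; apply/andP; split; rewrite leqNgt;
  apply/negP => /le_cumul h.
- by have := lt_le_trans iu uj; rewrite ltNge h.
- by have := lt_le_trans ju ui; rewrite ltNge h.
Qed.

Lemma digit_itv_cover : `]0, 1]%classic = \bigcup_(i : 'I_N) digit_itv i.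
Proof.
apply/seteqP; split => u.
  rewrite /= in_itv/= => /andP[u0 u1].
  (* The digit of [u] is the predecessor of the least [k] with [u <= cumul k]; this [k] is not 0
     because [u > 0]. *)
  have [|k uk kmin] := @ex_minnP (fun k => u <= cumul k); first by exists N; rewrite cumulN.
  have kN : (k <= N)%N by apply: kmin; rewrite cumulN.
  case: k uk kmin kN => [|k uk kmin kN]; first by rewrite cumul0 leNgt u0.
  exists (Ordinal kN) => //; rewrite /digit_itv/= in_itv/= -(cumulS (Ordinal kN)) uk andbT ltNge.
  by apply/negP => /kmin; rewrite ltnn.
move=> [i _]; rewrite /digit_itv/= !in_itv/= -cumulS => /andP[iu ui]; apply/andP; split.
  by rewrite (le_lt_trans _ iu)// -cumul0 le_cumul.
by rewrite (le_trans ui)// -cumulN le_cumul.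
Qed.

Definition digit_rescale (i : 'I_N) (u : R) : R := (u - cumul i) / g i.

Lemma measurable_digit_itv i : measurable (digit_itv i).
Proof. exact: measurable_itv. Qed.

Lemma measurable_digit_rescale i : measurable_fun setT (digit_rescale i).
Proof. by apply: measurable_funM => //; apply: measurable_funB. Qed.

Lemma digit_rescale_unit i u : digit_itv i u -> 0 < digit_rescale i u <= 1.
Proof.
rewrite /digit_itv/= in_itv/= /digit_rescale => /andP[iu ui].
have gi : 0 < g i by move: (lt_le_trans iu ui); rewrite ltrDl.
by rewrite divr_gt0 ?subr_gt0//= ler_pdivrMr// mul1r lerBlDl.
Qed.

Lemma lebesgue_digit i (A : set R) : measurable A ->
  lebesgue_measure (digit_itv i `&` digit_rescale i @^-1` A) =
  ((g i)%:E * lebesgue_measure (`]0%R, 1%R]%classic `&` A))%E.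
Proof.
move=> mA; move: (g0 i); rewrite le_eqVlt => /predU1P[gi|gi].
  rewrite -gi mul0e (_ : digit_itv i = set0) ?set0I ?measure0//.
  by apply/seteqP; split => // u; rewrite /digit_itv/= -gi addr0 in_itv/= lt_le_asym.
rewrite -(lebesgue_affine_preimage (cumul i) gi); last first.
  by apply: measurableI.
rewrite preimage_setI; congr (lebesgue_measure (_ `&` _)).
apply/seteqP; split => u /=; rewrite !in_itv/=.
  by move/digit_rescale_unit.
by rewrite ltr_pdivlMr// mul0r subr_gt0 ler_pdivrMr// mul1r lerBlDl.
Qed.

(** Self-similarity of Lebesgue measure on []0, 1]]: each digit interval is a copy of the whole,
    scaled by [g i]. The invariance equation will come from it. *)
Lemma lebesgue_digit_sum (A : set R) (B : 'I_N -> set R) :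
  (forall i, measurable (B i)) ->
  (forall i u, digit_itv i u -> A u <-> B i (digit_rescale i u)) ->
  lebesgue_measure (`]0%R, 1%R]%classic `&` A) =
  (\sum_(i < N) (g i)%:E * lebesgue_measure (`]0%R, 1%R]%classic `&` B i))%E.
Proof.
move=> mB AB.
have -> : `]0%R, 1%R]%classic `&` A =
    \big[setU/set0]_(i < N) (digit_itv i `&` digit_rescale i @^-1` B i).
  rewrite -bigcup_seq digit_itv_cover setI_bigcupl.
  apply: eq_bigcup => [|i _]; last first.
    by apply/seteqP; split => u [iu] /(AB _ _ iu).
  by split => i //= _; rewrite mem_index_enum.
set F := fun i => digit_itv i `&` digit_rescale i @^-1` B i.
have mF i : measurable (F i).
  apply: measurableI; first exact: measurable_digit_itv.
  by rewrite -[X in measurable X]setTI; exact: measurable_digit_rescale.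
have tF : trivIset setT F.
  by move=> i j _ _ [u [[iu _] [ju _]]]; exact: digit_itv_disjoint iu ju.
transitivity (\sum_(i < N) lebesgue_measure (F i))%E.
  exact: (@measure_bigsetU_ord _ _ _ (@lebesgue_measure R) N xpredT F).
by apply: eq_bigr => i _; exact: lebesgue_digit.
Qed.

End unit_interval_partition.

(** * Compactness and Lipschitz maps in metric spaces *)

Section metric_lemmas.
Context {R : realType} {M : metricType R}.

Lemma nbhs_mdist (x : M) (e : R) : 0 < e -> nbhs x [set y | mdist x y < e].
Proof. by move=> e0; rewrite -ballEmdist; exact: nbhsx_ballx. Qed.

Lemma open_mdist (U : set M) x : open U -> U x ->
  exists2 e : R, 0 < e & forall y, mdist x y < e -> U y.
Proof.
move=> oU Ux; have /nbhs_ballP[e /= e0 eU] : nbhs x U by exact: open_nbhs_nbhs.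
by exists e => // y xy; apply: eU; rewrite ballEmdist.
Qed.

Lemma lipschitz_continuous (f : M -> M) (q : R) :
  (forall x y, mdist (f x) (f y) <= q * mdist x y) -> continuous f.
Proof.
move=> fq x U /nbhs_ballP[e /= e0 eU].
have q10 : 0 < `|q| + 1 by rewrite ltr_wpDl.
apply: (filterS _ (nbhs_mdist x (divr_gt0 e0 q10))) => y /= xy.
apply: eU; rewrite ballEmdist/=; apply: (le_lt_trans (fq x y)).
apply: (@le_lt_trans _ _ ((`|q| + 1) * mdist x y)).
  by rewrite ler_wpM2r ?mdist_ge0// (le_trans (ler_norm q))// lerDl.
by rewrite mulrC -ltr_pdivlMr.
Qed.

Lemma compact_mdist_bounded (K : set M) : compact K ->
  exists2 D : R, 0 < D & forall x y, K x -> K y -> mdist x y <= D.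
Proof.
move=> cK; have [->|/set0P[a Ka]] := eqVneq K set0; first by exists 1.
have [] : \forall n \near \oo, K `<=` (fun x => mdist a x < n%:R).
  move/compact_near_coveringP : cK; apply => x Kx.
  exists ([set y | mdist x y < 1], [set n : nat | mdist a x + 1 <= n%:R]) => /=.
    split; first exact: nbhs_mdist.
    by near=> n; rewrite /= ltW//; near: n; exact: nbhs_infty_gtr.
  move=> [y n] /= [xy an]; apply: (lt_le_trans _ an).
  by apply: (le_lt_trans (metric_triangle a x y)); rewrite ltrD2l.
move=> n _ /(_ n (leqnn n)) Kn; exists (n%:R + n%:R).
  by rewrite addr_gt0// (le_lt_trans _ (Kn _ Ka))// mdistxx.
move=> x y Kx Ky; apply: (le_trans (metric_triangle x a y)).
by rewrite metric_sym lerD// ltW//; exact: Kn.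
Unshelve. all: by end_near. Qed.

Lemma nested_compact_nonempty (C : nat -> set M) : compact (C 0%N) ->
  (forall n, closed (C n)) -> (forall n, C n !=set0) ->
  (forall n, C n.+1 `<=` C n) -> exists x, forall n, C n x.
Proof.
move=> cC clC C0 CS.
have Cle m n : (m <= n)%N -> C n `<=` C m.
  elim: n => [|n IH]; first by rewrite leqn0 => /eqP->.
  rewrite leq_eqVlt => /predU1P[->//|/IH]; exact: subset_trans.
apply: contrapT => noC.
have [] : \forall n \near \oo, C 0%N `<=` (fun x => ~ C n x).
  move/compact_near_coveringP : cC; apply => x _.
  have [m Cmx] : exists m, ~ C m x by apply/existsNP => h; apply: noC; exists x.
  exists (~` C m, [set n | (m <= n)%N]) => /=.
    split; last by exists m.
    by apply: open_nbhs_nbhs; split => //; exact: closed_openC.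
  by move=> [y n] /= [Cmy mn] /(Cle _ _ mn).
move=> n _ /(_ n (leqnn n)) h; have [x Cx] := C0 n.
by apply: (h x) => //; exact: (Cle 0%N n) Cx.
Qed.

(** Contractivity bounds the quotients from above, so the supremum is an upper bound whenever there
    are two distinct points to compare. *)
Lemma mdist_le_lipschitz_const (f : M -> M) : contractive f ->
  forall x y, mdist (f x) (f y) <= lipschitz_const f * mdist x y.
Proof.
move=> [q /andP[q0 q1] fq] x y; have [->|xy] := eqVneq x y.
  by rewrite !mdistxx mulr0.
rewrite -ler_pdivrMr ?mdist_gt0//; apply: ub_le_sup; last by exists x, y.
exists q => _ [u [v [uv ->]]]; rewrite ler_pdivrMr ?mdist_gt0//.
Qed.

End metric_lemmas.

(** * Cylinders and their diameters *)

Section cylinders.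
Context {R : realType} {M : metricType R} {N : nat}.
Variables (S : 'I_N -> M -> M) (K : set M) (r : 'I_N -> R).
Hypothesis r01 : forall i, 0 < r i < 1.
Hypothesis Sr : forall i x y, mdist (S i x) (S i y) <= r i * mdist x y.
Hypothesis SK : forall i x, K x -> K (S i x).
Hypothesis cK : compact K.

Definition word_ratio (w : seq 'I_N) : R := \prod_(i <- w) r i.

Lemma word_ratio_gt0 w : 0 < word_ratio w.
Proof. by apply: prodr_gt0 => i _; case/andP: (r01 i). Qed.

Lemma compose_word_lipschitz w x y :
  mdist (compose_word S w x) (compose_word S w y) <= word_ratio w * mdist x y.
Proof.
rewrite /word_ratio; elim: w => [|i w IH] /=; first by rewrite big_nil mul1r.
rewrite big_cons -mulrA (le_trans (Sr _ _ _))// ler_pM2l//.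
by case/andP: (r01 i).
Qed.

Lemma compose_word_stable w x : K x -> K (compose_word S w x).
Proof. by elim: w => //= i w IH /IH; exact: SK. Qed.

Lemma continuous_compose_word w : continuous (compose_word S w).
Proof. exact: lipschitz_continuous (compose_word_lipschitz w). Qed.

Lemma cylinder_sub w : cylinder S K w `<=` K.
Proof. by move=> _ [x Kx <-]; exact: compose_word_stable. Qed.

Lemma cylinder_cons i w : cylinder S K (i :: w) = S i @` cylinder S K w.
Proof. by rewrite /cylinder -image_comp. Qed.

Lemma compact_cylinder w : compact (cylinder S K w).
Proof.
apply: continuous_compact => //; apply: continuous_subspaceT.
exact: continuous_compose_word.
Qed.

Lemma closed_cylinder w : closed (cylinder S K w).
Proof.
apply: compact_closed; [exact: metric_hausdorff|exact: compact_cylinder].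
Qed.

Lemma cylinder_mdist D w x y : (forall x y, K x -> K y -> mdist x y <= D) ->
  cylinder S K w x -> cylinder S K w y -> mdist x y <= word_ratio w * D.
Proof.
move=> KD [a Ka <-] [b Kb <-]; rewrite (le_trans (compose_word_lipschitz _ _ _))//.
by rewrite ler_pM2l ?word_ratio_gt0// KD.
Qed.

Lemma word_ratio_unif : exists2 q : R, 0 < q < 1 &
  forall w, word_ratio w <= q ^+ size w.
Proof.
(* The default [2^-1] keeps the maximum strictly between 0 and 1 even over an empty alphabet. *)
pose q := \big[Num.max/2^-1]_(i < N) r i.
have q0 : 0 < q.
  by rewrite /q; elim/big_rec : _ => // i x _ x0; rewrite lt_max x0 orbT.
have q1 : q < 1.
  rewrite /q; elim/big_rec : _ => [|i x _ x0]; last first.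
    by rewrite gt_max x0 andbT; case/andP : (r01 i).
  by rewrite invf_lt1// ltr1n.
exists q; first by rewrite q0.
rewrite /word_ratio; elim => [|i w IH]; first by rewrite big_nil.
rewrite big_cons exprS ler_pM//.
- by case/andP : (r01 i) => /ltW.
- exact/ltW/word_ratio_gt0.
- exact: le_bigmax.
Qed.

Lemma cylinder_small (e : R) : 0 < e -> \forall n \near \oo,
  forall w, size w = n -> forall x y,
  cylinder S K w x -> cylinder S K w y -> mdist x y < e.
Proof.
move=> e0; have [q /andP[q0 q1] rq] := word_ratio_unif.
have [D D0 KD] := compact_mdist_bounded cK.
have : \forall n \near \oo, `|D * q ^+ n| < e.
  have /cvgr0Pnorm_lt : geometric D q @ \oo --> 0.
    by apply: cvg_geometric; rewrite ger0_norm// ltW.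
  exact.
apply: filterS => n ne w wn x y wx wy.
apply: (le_lt_trans (cylinder_mdist KD wx wy)).
apply: le_lt_trans ne; rewrite ger0_norm; last by rewrite mulr_ge0 ?exprn_ge0 ?ltW.
by rewrite mulrC ler_pM2l// -wn.
Qed.

End cylinders.

(** * Coding points of the attractor by numbers of the unit interval *)

Section unit_lebesgue.
Context {R : realType}.

Definition unit_lebesgue : set (measurableTypeR R) -> \bar R :=
  mrestr lebesgue_measure (measurable_itv (`]0, 1] : interval R)).

HB.instance Definition _ := Measure.on unit_lebesgue.

Lemma unit_lebesgueE A :
  unit_lebesgue A = lebesgue_measure (`]0%R, 1%R]%classic `&` A).
Proof. by rewrite /unit_lebesgue /mrestr setIC. Qed.

Lemma unit_lebesgue_setT : unit_lebesgue setT = 1%E.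
Proof.
by rewrite unit_lebesgueE setIT lebesgue_measure_itv/= lte_fin ltr01 sube0.
Qed.

HB.instance Definition _ :=
  @Measure_isProbability.Build _ _ R unit_lebesgue unit_lebesgue_setT.

End unit_lebesgue.

Section coding.
Context {R : realType} {M : metricType R} {N : nat}.
Variables (i0 : 'I_N) (S : 'I_N -> M -> M) (K : set M) (K0 : K !=set0).
Variable r : 'I_N -> R.
Hypothesis r01 : forall i, 0 < r i < 1.
Hypothesis Sr : forall i x y, mdist (S i x) (S i y) <= r i * mdist x y.
Hypothesis SK : forall i x, K x -> K (S i x).
Hypothesis cK : compact K.
Context {Y : Type}.
Variables (H : 'I_N -> Y -> Y) (G : 'I_N -> Y -> R).
Hypothesis G0 : forall i y, 0 <= G i y.
Hypothesis G1 : forall y, \sum_(i < N) G i y = 1.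

(** Outside []0, 1]] no interval contains [u], and the digit is the default [i0]. *)
Definition digit (z : Y) (u : R) : 'I_N := xget i0 [set i | digit_itv (G ^~ z) i u].

Lemma digitE z u i : digit_itv (G ^~ z) i u -> digit z u = i.
Proof.
move=> iu; rewrite /digit; case: xgetP => [j _ ju|/(_ i)//].
exact: digit_itv_disjoint ju iu.
Qed.

(* The expansion of u in `]0, 1] in which, from the state z, the digit i has
   probability G i z and moves the state to H i z. *)
Fixpoint code (n : nat) (z : Y) (u : R) : seq 'I_N :=
  if n is n'.+1 then
    let i := digit z u in i :: code n' (H i z) (digit_rescale (G ^~ z) i u)
  else [::].

Lemma size_code n z u : size (code n z u) = n.
Proof. by elim: n z u => //= n IH z u; rewrite IH. Qed.

Lemma measurable_digit z i : measurable [set u | digit z u = i].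
Proof.
have -> : [set u | digit z u = i] = digit_itv (G ^~ z) i `|`
    (if i == i0 then ~` `]0, 1]%classic else set0).
  apply/seteqP; split => u /=.
    move=> <-; rewrite /digit; case: xgetP => [j _ ju|nu]; first by left.
    right; rewrite eqxx (digit_itv_cover (g := G ^~ z))// => -[j _]; exact: nu.
  move=> [/digitE//|]; case: eqP => [-> nu|//].
  rewrite /digit; case: xgetP => // j _ ju; exfalso; apply: nu.
  by rewrite (digit_itv_cover (g := G ^~ z))//; exists j.
apply: measurableU; first exact: measurable_digit_itv.
by case: ifP => _; [apply: measurableC; exact: measurable_itv|exact: measurable0].
Qed.

Lemma measurable_code n z w : measurable [set u | code n z u = w].
Proof.
elim: n z w => [|n IH] z w /=.
  have [<-|w0] := pselect ([::] = w).
    by rewrite (_ : [set _ | _] = setT)//; apply/seteqP; split.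
  by rewrite (_ : [set _ | _] = set0)//; apply/seteqP; split => // u [].
case: w => [|i w].
  by rewrite (_ : [set _ | _] = set0)//; apply/seteqP; split.
have -> : [set u | digit z u :: code n (H (digit z u) z)
    (digit_rescale (G ^~ z) (digit z u) u) = i :: w] =
    [set u | digit z u = i] `&`
    digit_rescale (G ^~ z) i @^-1` [set v | code n (H i z) v = w].
  apply/seteqP; split => u /=; first by case=> ui; rewrite ui.
  by case=> ui; rewrite ui => ->.
apply: measurableI; first exact: measurable_digit.
rewrite -[X in measurable X]setTI.
by apply: measurable_digit_rescale => //; exact: IH.
Qed.

Lemma code_nested n z u :
  cylinder S K (code n.+1 z u) `<=` cylinder S K (code n z u).
Proof.
elim: n z u => [|n IH] z u.
  by rewrite [X in _ `<=` X](_ : _ = K) ?/cylinder ?image_id//; exact: cylinder_sub.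
have E m : code m.+1 z u = digit z u :: code m (H (digit z u) z)
  (digit_rescale (G ^~ z) (digit z u) u) by [].
rewrite (E n.+1) (E n) cylinder_cons [X in _ `<=` X]cylinder_cons.
by apply: image_subset; exact: IH.
Qed.

Lemma code_point_exists z u :
  exists x : borel_type K0, forall n, cylinder S K (code n z u) (set_val_of x).
Proof.
have [||||x Cx] := @nested_compact_nonempty _ _ (fun n => cylinder S K (code n z u)).
- exact: compact_cylinder.
- by move=> n; exact: closed_cylinder.
- by move=> n; have [x Kx] := K0; exists (compose_word S (code n z u) x), x.
- by move=> n; exact: code_nested.
have Kx : K x by apply: cylinder_sub (Cx 0%N).
by exists (SigSub (mem_set Kx)) => n; exact: Cx.
Qed.

Definition code_point z u : borel_type K0 := sval (cid (code_point_exists z u)).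

Lemma code_pointP z u n :
  cylinder S K (code n z u) (set_val_of (code_point z u)).
Proof. exact: (svalP (cid (code_point_exists z u))). Qed.

Lemma code_point_unique z u x : (forall n, cylinder S K (code n z u) x) ->
  x = set_val_of (code_point z u).
Proof.
move=> Cx; apply/eqP; apply: contrapT => /negP; rewrite -mdist_gt0 => d0.
have [n _ /(_ n (leqnn n))] := cylinder_small r01 Sr cK d0.
move=> /(_ _ (size_code n z u) _ _ (Cx n) (code_pointP z u n)).
by rewrite ltxx.
Qed.

(** The right-hand side lies in every cylinder of the code of [u], and only one point does. Dropping
    the first digit thus corresponds to removing one map [S i]. *)
Lemma code_point_digit z u i : digit_itv (G ^~ z) i u ->
  set_val_of (code_point z u) =
  S i (set_val_of (code_point (H i z) (digit_rescale (G ^~ z) i u))).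
Proof.
move=> iu; apply/esym/code_point_unique => -[|n].
  rewrite /= /cylinder image_id; apply: SK.
  by have := code_pointP (H i z) (digit_rescale (G ^~ z) i u) 0; rewrite /cylinder image_id.
rewrite /= (digitE iu) cylinder_cons; eexists; last by [].
exact: code_pointP.
Qed.

Lemma measurable_code_point z :
  measurable_fun setT (code_point z : measurableTypeR R -> borel_type K0).
Proof.
apply: (@measurability _ _ (measurableTypeR R) (borel_type K0) setT
  (code_point z) (@open (nonempty_set_type K0))) => // _ [_ [V oV <-] <-].
rewrite setTI.
(* A coded point of the open set [V] has, by smallness, a whole cylinder of its code inside [V]. The
   preimage is therefore a union over the countably many words whose cylinder lies in [V]. *)
have -> : code_point z @^-1` (set_val @^-1` V) =
    \bigcup_(w : seq 'I_N) (if `[< cylinder S K w `<=` V >]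
       then [set u | code (size w) z u = w] else set0).
  apply/seteqP; split => u /=.
    move=> Vu; have [e e0 eV] := open_mdist oV Vu.
    have [n _ /(_ n (leqnn n)) ne] := cylinder_small r01 Sr cK e0.
    exists (code n z u) => //; case: asboolP => [_|[]] /=; first by rewrite size_code.
    by move=> x Cx; apply: eV; apply: ne Cx; [exact: size_code|exact: code_pointP].
  move=> [w _]; case: asboolP => //= wV uw; apply: wV.
  by have := code_pointP z u (size w); rewrite uw.
apply: countable_bigcupT_measurable => // w.
by case: ifP => // _; exact: measurable_code.
Qed.

Definition code_rv z : {mfun measurableTypeR R >-> borel_type K0} :=
  @mfun_Sub _ _ (measurableTypeR R) (borel_type K0) (code_point z)
    (mem_set (measurable_code_point z)).

Definition coded_measure z : probability (borel_type K0) R :=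
  distribution (@unit_lebesgue R) (code_rv z).

Lemma coded_measureE z A :
  coded_measure z A = lebesgue_measure (`]0%R, 1%R]%classic `&` code_point z @^-1` A).
Proof. exact: unit_lebesgueE. Qed.

End coding.

(** * Borel sets of the subspace K *)

Section borel_subset.
Context {R : realType} {M : metricType R} {K : set M} {K0 : K !=set0}.

Lemma set_val_of_inj : injective (@set_val_of R M K K0).
Proof. exact: val_inj. Qed.

Lemma set_val_ofP (x : borel_type K0) : K (set_val_of x).
Proof. by case: x => x Kx; exact: set_mem. Qed.

Lemma mem_set_val_of (A : set (borel_type K0)) x :
  (set_val_of @` A) (set_val_of x) <-> A x.
Proof. by split=> [[y Ay /set_val_of_inj <-//]|Ax]; exists x. Qed.

Lemma measurable_open_preimage (V : set M) : open V ->
  measurable (@set_val_of R M K K0 @^-1` V).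
Proof. by move=> oV; apply: sub_sigma_algebra; exists V. Qed.

Lemma measurable_closed_preimage (V : set M) : closed V ->
  measurable (@set_val_of R M K K0 @^-1` V).
Proof.
move=> cV; rewrite -[V]setCK preimage_setC; apply: measurableC.
exact: (measurable_open_preimage (closed_openC cV)).
Qed.

Lemma measurable_preimage_in (f : M -> M) (A : set (borel_type K0)) :
  continuous f -> (forall x, K x -> K (f x)) ->
  measurable A -> measurable (preimage_in f A).
Proof.
move=> cf fK mA.
(* The restriction of [f] to a self-map of [K], for which [preimage_in] is an ordinary preimage. *)
pose g (x : borel_type K0) : borel_type K0 :=
  SigSub (mem_set (fK _ (set_val_ofP x))).
have -> : preimage_in f A = g @^-1` A.
  apply/seteqP; split => x.
    case=> y Ay yx; have gx : g x = y by exact/esym/set_val_of_inj.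
    by rewrite -gx in Ay.
  by move=> Agx; exists (g x).
rewrite -[X in measurable X]setTI.
suff mg : measurable_fun setT g by exact: mg.
apply: (@measurability _ _ _ (borel_type K0) setT g (@open (nonempty_set_type K0))).
  by [].
move=> _ [_ [V oV <-] <-]; rewrite setTI.
apply: (measurable_open_preimage (V := f @^-1` V)).
by move/continuousP : cf; apply.
Qed.

End borel_subset.

(** * The invariance equation and its iterates *)

Section invariant_measures.
Context {R : realType} {M : metricType R} {N : nat}.
Variables (S : 'I_N -> M -> M) (K : set M) (K0 : K !=set0).
Variable r : 'I_N -> R.
Hypothesis r01 : forall i, 0 < r i < 1.
Hypothesis Sr : forall i x y, mdist (S i x) (S i y) <= r i * mdist x y.
Hypothesis SK : forall i x, K x -> K (S i x).
Context {Y : Type}.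
Variables (H : 'I_N -> Y -> Y) (G : 'I_N -> Y -> R).
Hypothesis G0 : forall i y, 0 <= G i y.
Hypothesis G1 : forall y, \sum_(i < N) G i y = 1.

Let continuous_S i : continuous (S i).
Proof. exact: lipschitz_continuous (Sr i). Qed.

(** Split by the first digit: for [u] with digit [i], the coded point is in [A] exactly when the
    rescaled number, read from [H i z], codes a point of the preimage of [A] under [S i]. *)
Lemma coded_measure_invariant (i0 : 'I_N) (cK : compact K) :
  invariant_family S H G
    (coded_measure i0 K0 r01 Sr SK cK H G0 G1).
Proof.
move=> z A mA; rewrite coded_measureE.
pose B i := code_point i0 K0 r01 Sr SK cK H G (H i z) @^-1` (preimage_in (S i) A).
rewrite (@lebesgue_digit_sum _ _ (G ^~ z) _ _ _ B)//.
- by apply: eq_bigr => i _; rewrite coded_measureE.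
- move=> i; rewrite -[X in measurable X]setTI.
  apply: measurable_code_point => //.
  by apply: measurable_preimage_in => //; exact: SK.
- move=> i u iu; apply: iff_trans (iff_sym (mem_set_val_of A _)) _.
  by rewrite (code_point_digit i0 K0 r01 Sr SK cK H G0 iu).
Qed.

Variable mu : Y -> probability (borel_type K0) R.
Hypothesis mu_inv : invariant_family S H G mu.

Local Open Scope ereal_scope.

Lemma invariant_family_iter n z (A : set (borel_type K0)) : measurable A ->
  mu z A = \sum_(w : n.-tuple 'I_N) (word_prob H G z w)%:E *
             mu (follow_word H w z) (preimage_in (compose_word S w) A).
Proof.
elim: n z A => [|n IH] z A mA.
  rewrite (big_tuple_nil (fun w => (word_prob H G z w)%:E *
             mu (follow_word H w z) (preimage_in (compose_word S w) A))).
  rewrite /= mul1e; congr (mu z _).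
  by apply/seteqP; split => x /mem_set_val_of.
rewrite (big_tuple_cons _ (fun w => (word_prob H G z w)%:E *
             mu (follow_word H w z) (preimage_in (compose_word S w) A))).
rewrite mu_inv//; apply: eq_bigr => i _.
have mSA : measurable (preimage_in (S i) A).
  by apply: measurable_preimage_in => //; exact: SK.
rewrite (IH _ _ mSA) ge0_sume_distrr; last first.
  by move=> w _; rewrite mule_ge0// lee_fin word_prob_ge0.
apply: eq_bigr => w _; rewrite muleA -EFinM; congr (_ * mu _ _).
apply/seteqP; split => x /=; rewrite /preimage_in /preimage/=.
  move=> [y + yx]; rewrite -yx => -[a Aa]; exists a => //.
move=> ASx; have Kwx : K (compose_word S w (set_val_of x)).
  by apply: compose_word_stable => //; exact: set_val_ofP.
by exists (SigSub (mem_set Kwx)).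
Qed.

(** In the iterated equation, a word whose cylinder misses [A] contributes nothing, and any other
    word at most its probability. *)
Lemma le_mass_meeting n z (A : set (borel_type K0)) : measurable A ->
  mu z A <= (\sum_(w : n.-tuple 'I_N |
    `[< cylinder S K w `&` set_val_of @` A !=set0 >]) word_prob H G z w)%:E.
Proof.
move=> mA; rewrite (invariant_family_iter n)// -sumEFin big_mkcond/=.
rewrite [leRHS]big_mkcond/=; apply: lee_sum => w _; case: asboolP => [_|wA].
  rewrite -[leRHS]mule1; apply: lee_wpmul2l; first by rewrite lee_fin word_prob_ge0.
  apply: probability_le1; apply: measurable_preimage_in => //.
    exact: (continuous_compose_word r01 Sr).
  by move=> x; exact: compose_word_stable.
rewrite (_ : preimage_in _ _ = set0) ?measure0 ?mule0//.
apply/seteqP; split => // x Ax; apply: wA; exists (compose_word S w (set_val_of x)).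
split; last exact: Ax.
by exists (set_val_of x) => //; exact: set_val_ofP.
Qed.

(** A word whose cylinder lies in [A] contributes its full probability, the preimage of [A] being
    all of [K]. *)
Lemma ge_mass_inside n z (A : set (borel_type K0)) : measurable A ->
  (\sum_(w : n.-tuple 'I_N |
    `[< cylinder S K w `<=` set_val_of @` A >]) word_prob H G z w)%:E <= mu z A.
Proof.
move=> mA; rewrite (invariant_family_iter n)// -sumEFin [leLHS]big_mkcond/=.
apply: lee_sum => w _; case: asboolP => [wA|_]; last first.
  by rewrite mule_ge0// lee_fin word_prob_ge0.
rewrite (_ : preimage_in _ _ = setT) ?probability_setT ?mule1//.
apply/seteqP; split => // x _; apply: wA.
by exists (set_val_of x) => //; exact: set_val_ofP.
Qed.

End invariant_measures.

(** * Uniqueness of the invariant family *)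

Section uniqueness.
Context {R : realType} {M : metricType R} {N : nat}.
Variables (S : 'I_N -> M -> M) (K : set M) (K0 : K !=set0).
Variable r : 'I_N -> R.
Hypothesis r01 : forall i, 0 < r i < 1.
Hypothesis Sr : forall i x y, mdist (S i x) (S i y) <= r i * mdist x y.
Hypothesis SK : forall i x, K x -> K (S i x).
Hypothesis cK : compact K.
Context {Y : Type}.
Variables (H : 'I_N -> Y -> Y) (G : 'I_N -> Y -> R).
Hypothesis G0 : forall i y, 0 <= G i y.

(* V is exhausted by the closed sets of points at distance at least 1 / k.+1
   from its complement; once the cylinders are smaller than this, those which
   meet such a set lie in V. *)
Lemma invariant_family_le_open (mu nu : Y -> probability (borel_type K0) R) z V :
  invariant_family S H G mu -> invariant_family S H G nu -> open V ->
  (nu z (set_val_of @^-1` V) <= mu z (set_val_of @^-1` V))%E.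
Proof.
move=> mu_inv nu_inv oV.
pose far (k : nat) := [set x : M | forall y, ~ V y -> k.+1%:R^-1 <= mdist y x].
have far_closed k : closed (far k).
  rewrite -[far k]setCK; apply: open_closedC.
  rewrite (_ : ~` far k = \bigcup_(y in ~` V) ball y k.+1%:R^-1); last first.
    apply/seteqP; split => x.
      move=> /existsNP[y /not_implyP[Vy yx]]; exists y => //.
      by rewrite ballEmdist/= ltNge; apply/negP.
    move=> [y Vy]; rewrite ballEmdist/= => yx /(_ y Vy).
    by rewrite leNgt yx.
  apply: bigcup_open => y _; rewrite openE => x; rewrite ballEmdist/= => yx.
  have d0 : 0 < k.+1%:R^-1 - mdist y x by rewrite subr_gt0.
  apply: filterS (nbhs_mdist x d0) => x' /= xx'.
  by rewrite (le_lt_trans (metric_triangle y x x'))// -ltrBrDl.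
have farV k : far k `<=` V.
  move=> x fx; apply: contrapT => /fx; rewrite mdistxx leNgt invr_gt0.
  by rewrite ltr0n.
have far_nd : nondecreasing_seq (fun k => @set_val_of R M K K0 @^-1` far k).
  move=> k l kl; apply/subsetPset => x fx y Vy; apply: le_trans (fx _ Vy).
  by rewrite lef_pV2 ?posrE ?ltr0n// ler_nat.
have VE : set_val_of @^-1` V = \bigcup_k (@set_val_of R M K K0 @^-1` far k).
  apply/seteqP; split => x; last by case=> k _ /farV.
  rewrite /preimage/= => Vx; have [e e0 eV] := open_mdist oV Vx.
  have [k ke] : exists k : nat, k.+1%:R^-1 < e.
    have [k /= _ /(_ k (leqnn k))] := near_infty_natSinv_lt (PosNum e0).
    by exists k.
  exists k => // y Vy; rewrite leNgt metric_sym; apply/negP => xy; apply: Vy.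
  by apply: eV; exact: lt_trans ke.
have mfar k : measurable (@set_val_of R M K K0 @^-1` far k).
  exact: measurable_closed_preimage.
have mV : measurable (@set_val_of R M K K0 @^-1` V).
  exact: measurable_open_preimage.
have nu_cvg : nu z \o (fun k => @set_val_of R M K K0 @^-1` far k) @ \oo -->
    nu z (set_val_of @^-1` V).
  by rewrite VE; apply: nondecreasing_cvg_mu => //; rewrite -VE.
rewrite -(cvg_lim _ nu_cvg)//; apply: lime_le.
  by apply/cvg_ex; eexists; exact: nu_cvg.
apply: nearW => k /=.
have k0 : (0 : R) < k.+1%:R^-1 by rewrite invr_gt0.
have [n _ /(_ n (leqnn n)) small] := cylinder_small r01 Sr cK k0.
(* Both bounds sum the same weights, which depend on [z], [H] and [G] but not on the family; it
   remains to compare the two sets of words. *)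
apply: (le_trans (le_mass_meeting r01 Sr SK G0 nu_inv n z (mfar k))).
apply: (le_trans _ (ge_mass_inside Sr SK G0 mu_inv n z mV)).
rewrite lee_fin [leLHS]big_mkcond [leRHS]big_mkcond/=; apply: ler_sum => w _.
case: asboolP => [[x [wx [x' fx' x'x]]]|_]; last first.
  by case: ifP => // _; exact: word_prob_ge0.
case: asboolP => // -[] a wa.
have Ka : K a by apply: cylinder_sub wa.
exists (SigSub (mem_set Ka)) => //=; rewrite /preimage/= /set_val_of/=.
rewrite -x'x in wx; apply: contrapT => /fx'; rewrite leNgt => /negP; apply.
by apply: small wa wx; rewrite size_tuple.
Qed.

(** Exchanging the two families gives equality on open sets, which are stable under intersection and
    generate the Borel sets. *)
Lemma invariant_family_unique (mu nu : Y -> probability (borel_type K0) R) z A :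
  invariant_family S H G mu -> invariant_family S H G nu -> measurable A ->
  nu z A = mu z A.
Proof.
move=> mu_inv nu_inv mA.
apply: (@measure_unique _ R (borel_type K0) (@open (nonempty_set_type K0)) (fun=> setT)) => //.
- exact: openI.
- by move=> i; exact: openT.
- by rewrite bigcup_const//; exists 0%N.
- by move=> _ [V oV <-]; apply/eqP; rewrite eq_le; apply/andP; split;
    apply: invariant_family_le_open.
- by move=> k; rewrite /= probability_setT ltry.
Qed.

End uniqueness.

(** * The mass distribution principle *)

Section mass_distribution.
Context {R : realType} {M : metricType R} {K : set M} {K0 : K !=set0}.

Lemma closed_mdist_le (x : M) (d : R) : closed [set y | mdist x y <= d].
Proof.
rewrite -[X in closed X]setCK; apply: open_closedC; rewrite openE => y /= xy.
have d0 : 0 < mdist x y - d by rewrite subr_gt0 ltNge; exact/negP.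
apply: filterS (nbhs_mdist y d0) => z /= yz xz; move: yz.
rewrite ltNge lerBlDr => /negP; apply.
by rewrite (le_trans (metric_triangle x z y))// addrC metric_sym lerD2l.
Qed.

Lemma le_diameter (A : set M) x y : A x -> A y -> ((mdist x y)%:E <= diameter A)%E.
Proof. by move=> Ax Ay; apply: ereal_sup_ubound; exists x => //; exists y. Qed.

Lemma diam_pow_ge0 (t : R) (A : set M) : (0 <= diam_pow t A)%E.
Proof. by rewrite /diam_pow; case: ifP => // _; exact: poweR_ge0. Qed.

(** A covering set that meets [K] lies, within [K], in a closed ball around one of its points with
    its diameter as radius. For [t < a] and diameters at most 1, [d ^ a <= d ^ t], so each cover has
    sum at least [C^-1] and the measure of dimension [t] cannot vanish. *)
Lemma mass_distribution (mu : probability (borel_type K0) R) (a C : R) :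
  0 < a -> 0 < C ->
  (forall (x : M) (d : R), K x -> 0 <= d <= 1 ->
    (mu (set_val_of @^-1` [set y | mdist x y <= d]%R) <= (C * d `^ a)%:E)%E) ->
  (a%:E <= measure_dim mu)%E.
Proof.
move=> a0 C0 muC.
apply: le_ereal_inf_tmp => _ [B [mB muB1] <-].
apply: le_ereal_inf_tmp => _ [t [t0 HtB] <-]; rewrite lee_fin leNgt; apply/negP => ta.
have : (C^-1%:E <= hausdorff_measure t (set_val_of @` B))%E; last first.
  by rewrite HtB leNgt lte_fin invr_gt0 C0.
(* The scale 1 suffices, the Hausdorff measure being a supremum over scales; it is also where the
   ball bound is available. *)
apply: (le_trans _ (ereal_sup_ubound
  (x := hausdorff_premeasure t 1 (set_val_of @` B)) _)); last first.
  by exists 1; [exact: ltr01|].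
apply: le_ereal_inf_tmp => _ [U [BU U1] <-].
have /choice[V VP] n : exists V : set (borel_type K0), [/\ measurable V,
    set_val_of @^-1` U n `<=` V & (mu V <= C%:E * diam_pow t (U n))%E].
  have [Un0|/set0P[x Ux]] := eqVneq (@set_val_of R M K K0 @^-1` U n) set0.
    exists set0; split; [exact: measurable0|by rewrite Un0|].
    by rewrite measure0 mule_ge0 ?diam_pow_ge0// lee_fin ltW.
  have d0 : (0 <= diameter (U n))%E.
    by have := le_diameter Ux Ux; rewrite mdistxx.
  have dfin : diameter (U n) \is a fin_num.
    by rewrite ge0_fin_numE// (le_lt_trans (U1 n))// ltry.
  pose d := fine (diameter (U n)).
  have dE : diameter (U n) = d%:E by rewrite fineK.
  have d01 : 0 <= d <= 1.
    by move: d0 (U1 n); rewrite dE !lee_fin => -> ->.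
  exists (set_val_of @^-1` [set y | mdist (set_val_of x) y <= d]); split.
  - exact: (measurable_closed_preimage (@closed_mdist_le (set_val_of x) d)).
  - by move=> z Uz; rewrite /preimage/= -lee_fin -dE; exact: le_diameter.
  apply: (le_trans (muC _ _ (set_val_ofP x) d01)).
  have -> : diam_pow t (U n) = (d `^ t)%:E.
    rewrite /diam_pow dE poweR_EFin ifF//; apply/negbTE/set0P.
    by exists (set_val_of x).
  rewrite -EFinM lee_fin ler_pM2l//.
  case/andP : d01; rewrite le_eqVlt => /predU1P[<- _|d0' d1].
    by rewrite powR0 ?gt_eqF// powR_ge0.
  rewrite /powR gt_eqF//= ler_expR.
  by rewrite ler_wnM2r ?ln_le0// ltW.
have : (1 <= \sum_(0 <= n <oo) C%:E * diam_pow t (U n))%E.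
  rewrite -muB1; apply: (@le_trans _ _ (\sum_(0 <= n <oo) mu (V n))%E).
    apply: measure_sigma_subadditive => //; first by move=> n; case: (VP n).
    move=> x Bx; have [|n _ Ux] := BU (set_val_of x); first by exists x.
    by exists n => //; have [_ UV _] := VP n; exact: UV.
  by apply: lee_nneseries => // n _; case: (VP n).
rewrite nneseriesZl//; last by move=> n _; exact: diam_pow_ge0.
by rewrite -lee_pdivrMl// mule1.
Qed.

End mass_distribution.

(** * Orbits of states and positivity of the dimension *)

Section orbits.
Context {R : realType} {N : nat} {Y : Type}.
Variables (H : 'I_N -> Y -> Y) (G : 'I_N -> Y -> R).

Lemma orbit_set_first y i : orbit_set H y (H i y).
Proof. by exists [:: i]. Qed.

Lemma orbit_set_next y i z : orbit_set H y z -> orbit_set H y (H i z).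
Proof.
move=> [w w1 <-]; exists (rcons w i); first by rewrite /= size_rcons.
by rewrite /follow_word foldl_rcons.
Qed.

Hypothesis G0 : forall i y, 0 <= G i y.

Lemma word_prob_le_exp (O : set Y) q z w : (forall i z, O z -> O (H i z)) ->
  (forall i z, O z -> G i z <= q) -> O z ->
  word_prob H G z w <= q ^+ size w.
Proof.
move=> OH Gq; elim: w z => //= i w IH z Oz; rewrite exprS.
by apply: ler_pM => //; [exact: word_prob_ge0|exact: Gq|apply: IH; exact: OH].
Qed.

End orbits.

Section positive_dimension.
Context {R : realType} {M : metricType R} {N : nat}.
Variables (S : 'I_N -> M -> M) (K : set M) (K0 : K !=set0).
Variable r : 'I_N -> R.
Hypothesis r01 : forall i, 0 < r i < 1.
Hypothesis Sr : forall i x y, mdist (S i x) (S i y) <= r i * mdist x y.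
Hypothesis SK : forall i x, K x -> K (S i x).
Context {Y : Type}.
Variables (H : 'I_N -> Y -> Y) (G : 'I_N -> Y -> R).
Hypothesis G01 : forall i y, 0 <= G i y <= 1.
Variable mu : Y -> probability (borel_type K0) R.
Hypothesis mu_inv : invariant_family S H G mu.
Variables (y : Y) (q rho c D : R).
Hypothesis q01 : 0 < q < 1.
Hypothesis Gq : forall i z, orbit_set H y z -> G i z <= q.
Hypothesis rho01 : 0 < rho < 1.
Hypothesis c0 : 0 < c.
Hypothesis D0 : 0 < D.
Hypothesis finite_clustering : forall (x : M) (m : nat), K x -> (1 <= m)%N ->
  #|[pred w : m.-tuple 'I_N |
     `[< closed_ball_in K x (c * rho ^+ m)
         `&` cylinder S K w !=set0 >]]|%:R <= D.

Let q0 : 0 < q. Proof. by case/andP: q01. Qed.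
Let q1 : q < 1. Proof. by case/andP: q01. Qed.
Let rho0 : 0 < rho. Proof. by case/andP: rho01. Qed.
Let rho1 : rho < 1. Proof. by case/andP: rho01. Qed.
Let G0 i z : 0 <= G i z. Proof. by case/andP: (G01 i z). Qed.

Lemma ball_mass_le_exp (x : M) (d : R) (m : nat) :
  K x -> d <= c * rho ^+ m.+1 ->
  (mu y (set_val_of @^-1` [set z | mdist x z <= d]%R) <= (D * q ^+ m)%:E)%E.
Proof.
move=> Kx dm.
have mball : measurable (@set_val_of R M K K0 @^-1` [set z | mdist x z <= d]).
  exact: (measurable_closed_preimage (@closed_mdist_le _ _ x d)).
apply: (le_trans (le_mass_meeting r01 Sr SK G0 mu_inv m.+1 y mball)).
rewrite lee_fin.
(* One factor [q] is lost: the first letter is read at [y], which need not belong to its own orbit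
   set. *)
have Pq (w : m.+1.-tuple 'I_N) : word_prob H G y w <= q ^+ m.
  case/tupleP: w => i w /=; rewrite -[leRHS]mul1r.
  apply: ler_pM => //; [exact: word_prob_ge0|by case/andP: (G01 i y)|].
  rewrite -[in leRHS](size_tuple w).
  apply: (word_prob_le_exp G0 (O := orbit_set H y)) => //.
  - by move=> j z; exact: orbit_set_next.
  - exact: orbit_set_first.
apply: (@le_trans _ _ (\sum_(w : m.+1.-tuple 'I_N |
    `[< closed_ball_in K x (c * rho ^+ m.+1) `&` cylinder S K w !=set0 >]) q ^+ m)).
  rewrite [leLHS]big_mkcond [leRHS]big_mkcond/=; apply: ler_sum => w _.
  case: asboolP => [[z [wz [x' xx' x'z]]]|_]; last first.
    by case: ifP => // _; rewrite exprn_ge0// ltW.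
  case: asboolP => // -[]; exists z; split => //; rewrite -x'z; split.
    exact: set_val_ofP.
  exact: le_trans dm.
rewrite big_const iter_addr_0 -mulr_natl ler_wpM2r ?exprn_ge0 ?(ltW q0)//.
exact: finite_clustering.
Qed.

Lemma measure_dim_gt0 : (0 < measure_dim (mu y))%E.
Proof.
have lnq : ln q < 0 by rewrite ln_lt0// q0.
have lnrho : ln rho < 0 by rewrite ln_lt0// rho0.
(* The exponent that converts the scale [rho] into the weight [q]. *)
pose a := ln q / ln rho.
have a0 : 0 < a by rewrite /a nmulr_rgt0// invr_lt0.
have rhoa : rho `^ a = q.
  by rewrite /powR gt_eqF// /a divfK ?lt_eqF// lnK// posrE.
(* The second term makes the bound at least 1 for radii above [c * rho]. In the first, [q ^+ 2]
   accounts for radii compared at level [m + 2] with a mass bound [D * q ^+ m]. *)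
pose C := Num.max (D * (c `^ a * q ^+ 2)^-1) ((c * rho) `^ a)^-1.
have crho0 : 0 < c * rho by rewrite mulr_gt0.
have C0 : 0 < C by rewrite lt_max orbC invr_gt0 powR_gt0.
suff : (a%:E <= measure_dim (mu y))%E by apply: lt_le_trans; rewrite lte_fin.
apply: (@mass_distribution _ _ _ _ _ a C) => // x d Kx /andP[d0 d1].
have mball : measurable (@set_val_of R M K K0 @^-1` [set z | mdist x z <= d]).
  exact: (measurable_closed_preimage (@closed_mdist_le _ _ x d)).
have [dlarge|dsmall] := ltP (c * rho) d.
  apply: (le_trans (probability_le1 _ mball)); rewrite lee_fin.
  apply: (@le_trans _ _ (((c * rho) `^ a)^-1 * d `^ a)); last first.
    by rewrite ler_wpM2r ?powR_ge0// le_max lexx orbT.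
  rewrite ler_pdivlMl ?powR_gt0// mulr1 ge0_ler_powR ?nnegrE//.
  - exact: ltW.
  - exact: ltW.
  - exact: ltW.
have small (b e : R) : 0 <= b < 1 -> 0 < e -> forall c' : R, exists n, c' * b ^+ n < e.
  move=> /andP[b0 b1] e0 c'.
  have /cvgr_lt : geometric c' b @ \oo --> 0.
    by apply: cvg_geometric; rewrite ger0_norm.
  by move=> /(_ _ e0)[n _ /(_ n (leqnn n))]; exists n.
(* At radius 0 the bound is 0, so the mass must vanish: the level estimate applies for every [m]. *)
move: d0; rewrite le_eqVlt => /predU1P[d0|d0].
  rewrite -d0 powR0 ?gt_eqF// mulr0.
  rewrite -(fineK (fin_num_measure (mu y) _ _)); last first.
    by rewrite d0.
  rewrite lee_fin; apply/ler_addgt0Pl => e e0; rewrite addr0.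
  have q01' : 0 <= q < 1 by rewrite ltW.
  have [n ne] := small q e q01' e0 D.
  apply/(le_trans _ (ltW ne)); rewrite -lee_fin fineK; last first.
    by rewrite fin_num_measure// d0.
  apply: ball_mass_le_exp => //.
  by rewrite mulr_ge0 ?exprn_ge0// ltW.
have rho01' : 0 <= rho < 1 by rewrite ltW.
(* The least [n] with [c * rho ^+ n < d] is at least 2 because [d <= c * rho], so [d] lies between
   two consecutive scales. *)
have [n nd nmin] := ex_minnP (small rho d rho01' d0 c).
case: n nd nmin => [|[|m]] nd nmin.
- move: nd; rewrite expr0 mulr1 => cd.
  by have := lt_le_trans cd dsmall; rewrite ltNge ler_piMr// ltW.
- by move: nd; rewrite expr1 ltNge dsmall.
have dm : d <= c * rho ^+ m.+1.
  by rewrite leNgt; apply/negP => /nmin; rewrite ltnn.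
apply: (le_trans (ball_mass_le_exp Kx dm)); rewrite lee_fin.
apply: (@le_trans _ _ (D * (c `^ a * q ^+ 2)^-1 * d `^ a)); last first.
  by rewrite ler_wpM2r ?powR_ge0// le_max lexx.
rewrite -mulrA ler_pM2l// ler_pdivlMl ?mulr_gt0 ?powR_gt0 ?exprn_gt0//.
have e : (c * rho ^+ m.+2) `^ a = c `^ a * q ^+ 2 * q ^+ m.
  rewrite powRM ?exprn_ge0 ?(ltW c0) ?(ltW rho0)// -mulrA -exprD add2n.
  rewrite -rhoa -!powR_mulrn ?powR_ge0 ?(ltW rho0)// -!powRrM.
  by rewrite [a * _]mulrC.
rewrite -e; apply: ge0_ler_powR; rewrite ?nnegrE; try exact: ltW.
by rewrite ltW// mulr_gt0// exprn_gt0.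
Qed.

End positive_dimension.

(** * Upper bound on the dimension from decay of the affinity *)

Lemma geometric_tail_le (R : realFieldType) (q : R) n L : 0 <= q < 1 ->
  \sum_(k < L | (n <= k)%N) q ^+ k <= q ^+ n / (1 - q).
Proof.
move=> /andP[q0 q1]; have q10 : 0 < 1 - q by rewrite subr_gt0.
rewrite ler_pdivlMr// mulrC.
(* The sum telescopes; [maxn L n] also covers [L <= n], where it is empty. *)
suff -> : (1 - q) * (\sum_(k < L | (n <= k)%N) q ^+ k) = q ^+ n - q ^+ maxn L n.
  by rewrite lerBlDr lerDl exprn_ge0.
elim: L => [|L IH]; first by rewrite big_ord0 mulr0 max0n subrr.
rewrite big_mkcond big_ord_recr/= -big_mkcond/= mulrDr IH.
case: (boolP (n <= L)%N) => [nL|].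
  by rewrite (maxn_idPl nL) (maxn_idPl (leqW nL)) exprS; ring.
by rewrite -ltnNge => Ln; rewrite mulr0 addr0 (maxn_idPr (ltnW Ln)) (maxn_idPr Ln).
Qed.

Section dimension_bound.
Context {R : realType} {M : metricType R} {N : nat}.
Variables (S : 'I_N -> M -> M) (K : set M) (K0 : K !=set0).
Variable r : 'I_N -> R.
Hypothesis r01 : forall i, 0 < r i < 1.
Hypothesis Sr : forall i x y, mdist (S i x) (S i y) <= r i * mdist x y.
Hypothesis SK : forall i x, K x -> K (S i x).
Hypothesis cK : compact K.
Variable s : R.
Hypothesis s0 : 0 < s.
Context {Y : Type}.
Variables (H : 'I_N -> Y -> Y) (G : 'I_N -> Y -> R).
Hypothesis G0 : forall i y, 0 <= G i y.
Hypothesis G1 : forall y, \sum_(i < N) G i y = 1.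
Variable mu : Y -> probability (borel_type K0) R.
Hypothesis mu_inv : invariant_family S H G mu.
Variables (y : Y) (gam C : R).
Hypothesis gam01 : 0 < gam < 1.
Hypothesis affinity_le : forall n,
  affinity H G (fun i => r i `^ s) n y <= C * gam ^+ n.

Let gam0 : 0 < gam. Proof. by case/andP: gam01. Qed.
Let gam1 : gam < 1. Proof. by case/andP: gam01. Qed.
Let r0 i : 0 < r i. Proof. by case/andP: (r01 i). Qed.

Lemma word_ratio_powR w : \prod_(i <- w) r i `^ s = word_ratio r w `^ s.
Proof.
rewrite /word_ratio; elim: w => [|i w IH]; first by rewrite !big_nil powR1.
rewrite !big_cons powRM ?IH//; first exact: ltW.
exact/ltW/word_ratio_gt0.
Qed.

(* Words whose natural weight r_w ^ s is exponentially smaller than their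
   probability: for long words they carry almost all the mass. *)
Definition light (w : seq 'I_N) : bool :=
  word_ratio r w `^ s <= gam ^+ size w * word_prob H G y w.

(** If [w] is not light then [gam ^+ n * P < r_w ^ s], where [P] is its probability, so
    [sqrt gam ^+ n * P] is at most its term [sqrt (P * r_w ^ s)] of the affinity. Dividing
    [C * gam ^+ n] by [sqrt gam ^+ n] leaves the rate [sqrt gam]. *)
Lemma sum_not_light n :
  \sum_(w : n.-tuple 'I_N | ~~ light w) word_prob H G y w <=
  C * Num.sqrt gam ^+ n.
Proof.
set h := Num.sqrt gam; have h0 : 0 < h by rewrite sqrtr_gt0.
have hE : h ^+ 2 = gam by rewrite sqr_sqrtr// ltW.
have hn0 : 0 < h ^+ n by rewrite exprn_gt0.
rewrite -(ler_pM2r hn0); apply: (@le_trans _ _ (C * gam ^+ n)); last first.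
  by rewrite -hE exprAC expr2 mulrA.
apply: le_trans (affinity_le n); rewrite affinityE//; last by move=> i; exact: powR_ge0.
rewrite mulr_suml big_mkcond/=; apply: ler_sum => w _.
case: ifP => [|_]; last exact: sqrtr_ge0.
rewrite -ltNge size_tuple => wl.
have P0 := word_prob_ge0 H G0 y w.
rewrite -[leLHS]ger0_norm ?mulr_ge0 ?(ltW hn0)// -sqrtr_sqr.
rewrite ler_wsqrtr// word_ratio_powR exprMn exprAC hE expr2 -mulrA.
by rewrite ler_wpM2l// mulrC ltW.
Qed.

Variables (t rmin : R).
Hypothesis t0 : 0 < t.
Hypothesis ts : t < s.
Hypothesis rmin0 : 0 < rmin.
Hypothesis rmin_le : forall i, rmin <= r i.
(** Lowering the exponent from [s] to [t] costs at most [rmin ^ (t - s)] per letter; [kap] is the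
    rate that remains. *)
Let kap := gam / rmin `^ (s - t).

Lemma word_ratio_ge w : rmin ^+ size w <= word_ratio r w.
Proof.
rewrite /word_ratio; elim: w => [|i w IH]; first by rewrite big_nil.
by rewrite big_cons exprS ler_pM ?exprn_ge0// ltW.
Qed.

Lemma light_word_ratio w : light w ->
  word_ratio r w `^ t <= kap ^+ size w * word_prob H G y w.
Proof.
move=> lw; have w0 := word_ratio_gt0 r01 w.
have st0 : 0 <= s - t by rewrite subr_ge0 ltW.
have -> : word_ratio r w `^ t = word_ratio r w `^ s / word_ratio r w `^ (s - t).
  rewrite -{1}(subKr s t) [LHS]powRB//.
  by apply/implyP => _; rewrite gt_eqF.
have -> : kap ^+ size w * word_prob H G y w =
    gam ^+ size w * word_prob H G y w / (rmin ^+ size w) `^ (s - t).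
  have -> : (rmin ^+ size w) `^ (s - t) = (rmin `^ (s - t)) ^+ size w.
    by rewrite -!powR_mulrn ?powR_ge0 ?(ltW rmin0)// -!powRrM mulrC.
  by rewrite /kap expr_div_n mulrAC.
apply: ler_pM => //; rewrite ?invr_ge0 ?powR_ge0//.
rewrite lef_pV2 ?posrE ?powR_gt0 ?exprn_gt0//.
by apply: ge0_ler_powR => //; rewrite ?nnegrE ?exprn_ge0 ?word_ratio_ge ?ltW.
Qed.

Lemma sum_light_word_ratio n :
  \sum_(w : n.-tuple 'I_N | light w) word_ratio r w `^ t <= kap ^+ n.
Proof.
have kap0 : 0 <= kap by rewrite divr_ge0 ?powR_ge0// ltW.
rewrite -[leRHS]mulr1 -(sum_word_prob H G1 n y) mulr_sumr big_mkcond/=.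
apply: ler_sum => w _; case: ifP => [/light_word_ratio|_].
  by rewrite size_tuple.
by rewrite mulr_ge0 ?exprn_ge0 ?word_prob_ge0.
Qed.

Definition light_cylinders (n : nat) : set (borel_type K0) :=
  \bigcup_(w in [set w : seq 'I_N | (n <= size w)%N && light w])
    (set_val_of @^-1` cylinder S K w).

Definition light_limsup : set (borel_type K0) := \bigcap_n light_cylinders n.

Lemma measurable_light_cylinders n : measurable (light_cylinders n).
Proof.
rewrite /light_cylinders bigcup_mkcond; apply: countable_bigcupT_measurable => // w.
case: ifP => _; last exact: measurable0.
apply: measurable_closed_preimage; exact: (closed_cylinder r01 Sr cK).
Qed.

Lemma measurable_light_limsup : measurable light_limsup.
Proof. by apply: bigcapT_measurable; exact: measurable_light_cylinders. Qed.

(** The light words of one level [k >= n] already carry mass at least [1 - C * sqrt gam ^+ k], and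
    [k] is arbitrary. *)
Lemma mass_light_cylinders n : mu y (light_cylinders n) = 1%E.
Proof.
have mA := measurable_light_cylinders n.
apply/eqP; rewrite eq_le probability_le1//=.
have h01 : `|Num.sqrt gam| < 1.
  by rewrite ger0_norm ?sqrtr_ge0// -[ltRHS]sqrtr1 ltr_sqrt.
apply/lee_addgt0Pr => e e0.
have /cvgr_lt : geometric C (Num.sqrt gam) @ \oo --> 0 by exact: cvg_geometric.
move=> /(_ _ e0) [m _ me].
have {me} := me (maxn m n) (leq_maxl _ _); rewrite /geometric/=.
have : (n <= maxn m n)%N by exact: leq_maxr.
move: (maxn m n) => k nk ke.
rewrite -leeBlDr//.
apply: le_trans (ge_mass_inside Sr SK G0 mu_inv k y mA).
rewrite -EFinB lee_fin lerBlDr -[leLHS](sum_word_prob H G1 k y).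
rewrite [leLHS](bigID (fun w : k.-tuple 'I_N => light w))/=.
apply: lerD; last exact: le_trans (sum_not_light k) (ltW ke).
rewrite [leLHS]big_mkcond [leRHS]big_mkcond/=; apply: ler_sum => w _.
case: ifP => [lw|_]; last by case: ifP => // _; exact: word_prob_ge0.
case: asboolP => // -[] _ [x Kx <-].
have Kw : K (compose_word S w x) by exact: compose_word_stable.
exists (SigSub (mem_set Kw)) => //; exists w; last by exists x.
by rewrite /= size_tuple nk.
Qed.

Lemma mass_light_limsup : mu y light_limsup = 1%E.
Proof.
have nd : nonincreasing_seq light_cylinders.
  move=> m n mn; apply/subsetPset => x [w /andP[nw lw] wx]; exists w => //=.
  by rewrite lw (leq_trans mn nw).
have fin0 : (mu y (light_cylinders 0) < +oo)%E by rewrite mass_light_cylinders ltry.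
have cv := nonincreasing_cvg_mu fin0 measurable_light_cylinders
  measurable_light_limsup nd.
rewrite -(cvg_lim _ cv)//; apply: lim_near_cst => //.
by apply: nearW => n /=; rewrite mass_light_cylinders.
Qed.

Hypothesis kap1 : kap < 1.

(* pickle_inv, unlike unpickle, lists each word at most once. *)
Definition light_cover (n k : nat) : set M :=
  if pickle_inv k is Some w then
    if (n <= size w)%N && light w then cylinder S K w else set0
  else set0.

Lemma light_limsup_cover n : set_val_of @` light_limsup `<=` \bigcup_k light_cover n k.
Proof.
move=> _ [x xB <-]; have [w /= nw wx] := xB n I.
by exists (pickle w) => //; rewrite /light_cover pickleK_inv nw.
Qed.

(** A cylinder has diameter at most [word_ratio r w * D], so the light words of level [k] contribute
    at most [D ^ t * kap ^+ k]; the levels from [n] on form a geometric tail. *)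
Lemma sum_light_cover : exists2 D : R, 0 < D & forall n,
  (\sum_(0 <= k <oo) diam_pow t (light_cover n k) <= (D * kap ^+ n)%:E)%E.
Proof.
have kap0 : 0 <= kap by rewrite divr_ge0 ?powR_ge0// ltW.
have kap10 : 0 < 1 - kap by rewrite subr_gt0.
have [D D0 KD] := compact_mdist_bounded cK.
exists (D `^ t / (1 - kap)); first by rewrite divr_gt0// powR_gt0.
move=> n.
pose F (w : seq 'I_N) :=
  if (n <= size w)%N && light w then D `^ t * word_ratio r w `^ t else 0.
have F0 w : 0 <= F w by rewrite /F; case: ifP => // _; rewrite mulr_ge0 ?powR_ge0.
have coverF k : (diam_pow t (light_cover n k) <= (oapp F 0 (pickle_inv k))%:E)%E.
  rewrite /light_cover; case: pickle_inv => [w|]; last by rewrite /diam_pow eqxx.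
  rewrite /= /F; case: ifP => _; last by rewrite /diam_pow eqxx.
  rewrite /diam_pow; case: ifP => [_|/negbT/set0P[x wx]].
    by rewrite lee_fin mulr_ge0 ?powR_ge0.
  have wD : (diameter (cylinder S K w) <= (word_ratio r w * D)%:E)%E.
    apply: ge_ereal_sup => _ [a wa [b wb <-]]; rewrite lee_fin.
    exact: (cylinder_mdist r01 Sr KD).
  have d0 : (0 <= diameter (cylinder S K w))%E.
    by have := le_diameter wx wx; rewrite mdistxx.
  have dfin : diameter (cylinder S K w) \is a fin_num.
    by rewrite ge0_fin_numE// (le_lt_trans wD)// ltry.
  have := fineK dfin; set d := fine _ => dE.
  rewrite -dE !lee_fin in d0 wD *.
  rewrite mulrC -powRM ?(ltW D0) ?(ltW (word_ratio_gt0 r01 w))//.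
  apply: ge0_ler_powR; rewrite ?nnegrE ?mulr_ge0 ?(ltW t0) ?(ltW D0)//.
  exact/ltW/word_ratio_gt0.
apply: lime_le.
  by apply: is_cvg_nneseries => k _ _; exact: diam_pow_ge0.
apply: nearW => m.
apply: (@le_trans _ _ (\sum_(0 <= k < m) (oapp F 0 (pickle_inv k))%:E)%E).
  by apply: lee_sum => k _; exact: coverF.
(* A partial sum over codes is a sum over finitely many distinct words, hence over words of bounded
   length. *)
rewrite sumEFin lee_fin -big_pmap.
set u := pmap _ _.
have uu : uniq u by apply: (pmap_uniq pickle_invK); exact: iota_uniq.
have uL w : w \in u -> (size w < (\max_(v <- u) size v).+1)%N.
  by move=> wu; rewrite ltnS; apply: leq_bigmax_seq.
apply: (le_trans (big_tuple_seq F0 uu uL)).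
move: (_.+1) => L.
rewrite -mulrA [_^-1 * _]mulrC.
apply: le_trans (_ : D `^ t * (\sum_(k < L | (n <= k)%N) kap ^+ k) <= _); last first.
  by rewrite ler_pM2l ?powR_gt0// geometric_tail_le// kap0.
rewrite mulr_sumr [leRHS]big_mkcond; apply: ler_sum => k _.
case: ifP => nk; last by rewrite big1// => w _; rewrite /F size_tuple nk.
apply: le_trans (_ : D `^ t * (\sum_(w : k.-tuple 'I_N | light w) word_ratio r w `^ t) <= _).
  rewrite mulr_sumr [leRHS]big_mkcond; apply: ler_sum => w _.
  by rewrite /F size_tuple nk.
by rewrite ler_pM2l ?powR_gt0// sum_light_word_ratio.
Qed.

Lemma hausdorff_measure_light_limsup :
  hausdorff_measure t (set_val_of @` light_limsup) = 0%E.
Proof.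
apply/eqP; rewrite eq_le; apply/andP; split; last first.
  apply: (@le_trans _ _ (hausdorff_premeasure t 1 (set_val_of @` light_limsup))).
    apply: le_ereal_inf_tmp => _ [U _ <-].
    by apply: nneseries_ge0 => n _ _; exact: diam_pow_ge0.
  by apply: ereal_sup_ubound; exists 1; [exact: ltr01|].
apply: ge_ereal_sup => _ [delta /= delta0 <-].
have [D D0 Dle] := sum_light_cover.
apply/lee_addgt0Pr => e e0; rewrite add0e.
have kapn : `|kap| < 1 by rewrite ger0_norm// divr_ge0 ?powR_ge0// ltW.
have /cvgr_lt : geometric D kap @ \oo --> 0 by exact: cvg_geometric.
move=> /(_ _ e0) [m _ me].
have [m' _ m'e] := cylinder_small r01 Sr cK delta0.
(* Large enough both for the sum to be below [e] and for the cylinders to have diameter at most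
   [delta]. *)
pose n := maxn m m'.
apply: (@le_trans _ _ (\sum_(0 <= k <oo) diam_pow t (light_cover n k))%E).
  apply: ereal_inf_lbound; exists (light_cover n) => //; split.
    exact: light_limsup_cover.
  move=> k; apply: ge_ereal_sup => _ [a ka [b kb <-]].
  rewrite lee_fin ltW//; move: ka kb; rewrite /light_cover.
  case: pickle_inv => [w|//]; case: ifP => [/andP[nw _]|//].
  by apply: (m'e (size w)) => //; exact: leq_trans (leq_maxr _ _) nw.
apply: (le_trans (Dle n)); rewrite lee_fin ltW//.
by apply: me; exact: leq_maxl.
Qed.

Lemma measure_dim_le : (measure_dim (mu y) <= t%:E)%E.
Proof.
apply: (@le_trans _ _ (hausdorff_dim (set_val_of @` light_limsup))).
  apply: ereal_inf_lbound; exists light_limsup => //; split.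
    exact: measurable_light_limsup.
  exact: mass_light_limsup.
apply: ereal_inf_lbound; exists t => //=; split; first exact: ltW.
exact: hausdorff_measure_light_limsup.
Qed.

End dimension_bound.

(** * Strict inequality for the dimension *)

Section dimension_drop.
Context {R : realType} {M : metricType R} {N : nat}.
Variables (S : 'I_N -> M -> M) (K : set M) (K0 : K !=set0).
Variable r : 'I_N -> R.
Hypothesis r01 : forall i, 0 < r i < 1.
Hypothesis Sr : forall i x y, mdist (S i x) (S i y) <= r i * mdist x y.
Hypothesis SK : forall i x, K x -> K (S i x).
Hypothesis cK : compact K.
Variable s : R.
Hypothesis s0 : 0 < s.
Hypothesis sE : \sum_(i < N) r i `^ s = 1.
Context {Y : Type}.
Variables (H : 'I_N -> Y -> Y) (G : 'I_N -> Y -> R).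
Hypothesis G0 : forall i y, 0 <= G i y.
Hypothesis G1 : forall y, \sum_(i < N) G i y = 1.
Variable mu : Y -> probability (borel_type K0) R.
Hypothesis mu_inv : invariant_family S H G mu.

Lemma measure_dim_lt_of_affinity y gam C : 0 < gam < 1 ->
  (forall n, affinity H G (fun i => r i `^ s) n y <= C * gam ^+ n) ->
  (measure_dim (mu y) < s%:E)%E.
Proof.
move=> gam01 affC; have /andP[gam0 gam1] := gam01.
pose rmin := \big[Num.min/2^-1]_(i < N) r i.
have rmin0 : 0 < rmin.
  rewrite /rmin; elim/big_rec : _ => // i x _ x0; rewrite lt_min x0 andbT.
  by case/andP : (r01 i).
have rmin1 : rmin < 1.
  by rewrite (le_lt_trans (bigmin_le_id _ _ _ _))// invf_lt1// ltr1n.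
have rmin_le i : rmin <= r i by exact: bigmin_le.
have lng : ln gam < 0 by rewrite ln_lt0.
have lnr : ln rmin < 0 by rewrite ln_lt0// rmin0.
(* The bound [s / 2] keeps [t = s - delta] positive; the other gives
   [delta * ln rmin >= ln gam / 2 > ln gam], that is, [kap < 1]. *)
pose delta := Num.min (s / 2) (ln gam / ln rmin / 2).
have delta0 : 0 < delta.
  by rewrite lt_min divr_gt0//= divr_gt0// nmulr_rgt0// invr_lt0.
have deltas : delta < s by rewrite gt_min ltr_pdivrMr// ltr_pMr// ltr1n.
have t0 : 0 < s - delta by rewrite subr_gt0.
have ts : s - delta < s by rewrite ltrBlDr ltrDl.
have kap1 : gam / rmin `^ (s - (s - delta)) < 1.
  rewrite subKr ltr_pdivrMr ?powR_gt0// mul1r /powR gt_eqF//.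
  rewrite -[ltLHS]lnK ?posrE// ltr_expR.
  have : delta <= ln gam / ln rmin / 2 by rewrite ge_min lexx orbT.
  rewrite -(ler_nM2r lnr) mulrAC divfK ?lt_eqF//; apply: lt_le_trans.
  by rewrite ltr_pdivlMr//; lra.
apply: le_lt_trans (_ : (s - delta)%:E < s%:E)%E; last by rewrite lte_fin.
exact: (measure_dim_le r01 Sr SK cK G0 G1 mu_inv gam01 affC t0 ts rmin0 rmin_le kap1).
Qed.

Lemma measure_dim_lt y (e : R) (l : nat) : 0 < e < 1 ->
  (forall z (w : l.-tuple 'I_N), orbit_set H y z ->
    (exists i, e < `|G i z - r i `^ s|) \/
    (exists i, e < `|G i (follow_word H w z) - r i `^ s|)) ->
  (measure_dim (mu y) < s%:E)%E.
Proof.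
move=> e01 bad.
have p0 i : 0 <= r i `^ s by exact: powR_ge0.
have OH i z : orbit_set H y z -> orbit_set H y (H i z) by exact: orbit_set_next.
have [gam [C [gam01 C0 decay]]] := affinity_decay G0 G1 p0 sE OH e01 bad.
have /andP[gam0 gam1] := gam01.
(* The decay holds on the orbit set, which may miss [y]: the first letter is read without gain, at
   the cost of [gam^-1]. The 1 in the maximum serves the empty word. *)
apply: (@measure_dim_lt_of_affinity y gam (Num.max 1 (C / gam))) => // -[|n].
  by rewrite expr0 mulr1 le_max lexx.
rewrite /affinity iterS -/(affinity _ _ _ n).
apply: (@le_trans _ _ (affinity H G (fun i => r i `^ s) 1 y * (C * gam ^+ n))).
  by apply: affinity_step_le => i; apply: decay; exact: orbit_set_first.
apply: (@le_trans _ _ (C / gam * gam ^+ n.+1)).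
  have -> : C / gam * gam ^+ n.+1 = C * gam ^+ n.
    by rewrite exprS mulrA divfK ?gt_eqF.
  rewrite ler_piMl ?affinity1_le1//.
  by rewrite mulr_ge0 ?exprn_ge0 ?ltW.
by rewrite ler_wpM2r ?exprn_ge0 ?(ltW gam0)// le_max lexx orbT.
Qed.

End dimension_drop.

(* The minimum of the r i is taken with default 1, which is never attained
   since r i < 1. *)
Theorem theorem1p1 (R : realType) (M : completeMetricType R) (N : nat)
    (N2 : (2 <= N)%N)
    (S : 'I_N -> M -> M) (S_contr : forall i, contractive (S i))
    (K : set M) (K0 : K !=set0) (K_compact : compact K)
    (K_inv : K = \bigcup_(i in [set: 'I_N]) (S i @` K))
    (r : 'I_N -> R) (rE : forall i, r i = lipschitz_const (S i))
    (r01 : forall i, 0 < r i < 1)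
    (s : R) (s0 : 0 < s) (sE : \sum_(i < N) r i `^ s = 1)
    (Y : Type) (H : 'I_N -> Y -> Y) (G : 'I_N -> Y -> R)
    (G01 : forall i y, 0 <= G i y <= 1)
    (G1 : forall y, \sum_(i < N) G i y = 1) :
  exists mu : Y -> probability (borel_type K0) R,
    [/\ invariant_family S H G mu,
        (forall nu : Y -> probability (borel_type K0) R,
           invariant_family S H G nu ->
           forall y (A : set (borel_type K0)), measurable A ->
             nu y A = mu y A)
      & forall y : Y,
          ((exists (eps0 : R) (l : nat),
              [/\ 0 < eps0 < (\big[Num.min/1]_(i < N) r i) `^ s,
                  (1 <= l)%N
                & forall w : l.-tuple 'I_N,
                    orbit_set H y
                    `&` \bigcap_(i in [set: 'I_N])
                          (G i @^-1` `[r i `^ s - eps0, r i `^ s + eps0])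
                    `&` \bigcap_(j in [set: 'I_N])
                          ((G j \o follow_word H w)
                             @^-1` `[r j `^ s - eps0, r j `^ s + eps0])
                    = set0]) ->
            (measure_dim (mu y) < s%:E)%E)
          /\
          ((exists rho c D : R,
              [/\ 0 < rho < 1, 0 < c, 0 < D
                & forall (x : M) (m : nat), K x -> (1 <= m)%N ->
                    #|[pred w : m.-tuple 'I_N |
                       `[< closed_ball_in K x (c * rho ^+ m)
                           `&` cylinder S K w !=set0 >]]|%:R <= D]) ->
           (exists (i : 'I_N) (c' : R),
              [/\ 0 < c',
                  c' <= inf (G i @` orbit_set H y),
                  inf (G i @` orbit_set H y) <= sup (G i @` orbit_set H y)
                & sup (G i @` orbit_set H y) <= 1 - c']) ->
            (0 < measure_dim (mu y))%E)].
Proof.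
pose i0 : 'I_N := Ordinal (ltnW N2).
have G0 i y : 0 <= G i y by case/andP: (G01 i y).
have Sr i x y : mdist (S i x) (S i y) <= r i * mdist x y.
  by rewrite rE; exact: mdist_le_lipschitz_const.
have SK i x : K x -> K (S i x) by move=> Kx; rewrite K_inv; exists i => //; exists x.
pose mu := coded_measure i0 K0 r01 Sr SK K_compact H G0 G1.
have mu_inv : invariant_family S H G mu by exact: coded_measure_invariant.
exists mu; split=> // [nu nu_inv y A mA|y].
  exact: (invariant_family_unique r01 Sr SK K_compact G0 _ mu_inv nu_inv mA).
split=> [[eps0 [l [/andP[e0 e1] l1 gap]]]|].
  apply: (measure_dim_lt (e := eps0) (l := l) r01 Sr SK K_compact s0 sE G0 G1 mu_inv).
    rewrite e0 (lt_le_trans e1)//.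
    have m1 : \big[Num.min/1]_(i < N) r i <= 1 := bigmin_le_id _ _ _ _.
    have m0 : 0 <= \big[Num.min/1]_(i < N) r i.
      elim/big_rec : _ => // i x _ x0; rewrite le_min x0 andbT.
      by case/andP : (r01 i) => /ltW.
    apply: le_trans (_ : 1 `^ s <= 1); last by rewrite powR1.
    by apply: ge0_ler_powR; rewrite ?nnegrE// ltW.
  (* A state violating the alternative would belong to the intersection assumed empty. *)
  move=> z w Oz; apply: contrapT => /not_orP[gz gw].
  have near_p v : ~ (exists i, eps0 < `|G i v - r i `^ s|) ->
      forall i, (`[r i `^ s - eps0, r i `^ s + eps0]%classic : set R) (G i v).
    move=> nv i; rewrite /= in_itv/= -ler_distl leNgt; apply/negP => h.
    by apply: nv; exists i.
  suff : (set0 : set Y) z by [].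
  by rewrite -(gap w); split; [split=> // i _|move=> i _]; apply: near_p.
move=> [rho [c [D [rho01 c0 D0 clust]]]] [i [c' [c'0 c'inf infsup supc']]].
(* The values of [G i] lie in [[0, 1]], so the supremum and infimum over the orbit are genuine
   bounds. *)
have Gub z : orbit_set H y z -> G i z <= 1 - c'.
  move=> Oz; apply: le_trans supc'; apply: ub_le_sup; last by exists z.
  by exists 1 => _ [v _ <-]; case/andP: (G01 i v).
have Glb z : orbit_set H y z -> c' <= G i z.
  move=> Oz; apply: le_trans c'inf _; apply: ge_inf; last by exists z.
  by exists 0 => _ [v _ <-]; case/andP: (G01 i v).
have q01 : 0 < 1 - c' < 1.
  rewrite (lt_le_trans c'0)/=; last exact: le_trans c'inf (le_trans infsup supc').
  by rewrite ltrBlDr ltrDl.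
(* A single letter controls all of them: for [j != i], [G j z <= 1 - G i z <= 1 - c']. *)
have Gq j z : orbit_set H y z -> G j z <= 1 - c'.
  move=> Oz; have [->|ji] := eqVneq j i; first exact: Gub.
  rewrite lerBrDr; apply: (@le_trans _ _ (G j z + G i z)).
    by rewrite lerD2l Glb.
  rewrite -(G1 z) (bigD1 j)//= lerD2l (bigD1 i)/=; last by rewrite eq_sym.
  by rewrite lerDl sumr_ge0.
exact: (measure_dim_gt0 r01 Sr SK G01 mu_inv q01 Gq rho01 c0 D0 clust).
Qed.
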